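(* In a purely relational language, or in a language with only relation symbols plus one unary function symbol, every infinite time decidable model has an infinite time computable presentation.
   Context: Infinite time Turing machines: three-tape machines with finite programs; successor steps as classically; at limit stages the head returns to the leftmost cell, a special limit state is entered and each cell takes the $\limsup$ of its previous values. Reals are elements of $2^\omega$; (infinite time) computable functions and decidable sets are those computed/decided by such machines. Languages are computably presented: each symbol has a Gödel code (a real), the set of codes is decidable, kind and arity are computable from codes, logical symbols coded in $\mathbb{N}$. A decidable model is a structure whose universe is a decidable set of reals and whose elementary diagram $\{\varphi[\vec a]:\mathcal{A}\models\varphi[\vec a]\}$ is decidable. A computable structure has decidable universe and functions, relations, constants uniformly computable from inputs and Gödel codes; a computable presentation of a structure is an isomorphic computable structure. *)

(* Defs.v *)
From mathcomp Require Import all_boot.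
From mathcomp Require Import boolp classical_sets wochoice.

Set Implicit Arguments.
Unset Strict Implicit.
Unset Printing Implicit Defensive.

Local Open Scope classical_set_scope.

(** A real is an element of Cantor space. *)
Definition real := nat -> bool.

Inductive direction := Left | Right.

(** A program is a finite transition table.  One head scans the same position
    of the three tapes (input, scratch, output) simultaneously. *)
Record ittm := Ittm {
  state : finType;
  start : state;
  limit : state;
  halt : state;
  special_states : uniq [:: start; limit; halt];
  delta : state -> bool * bool * bool -> state * (bool * bool * bool) * direction
}.

Record config (M : ittm) := Config {
  cstate : state M;
  head : nat;
  tin : real;
  tscr : real;
  tout : real
}.

Definition zeros : real := fun=> false.

Definition initial (M : ittm) (x : real) : config M :=
  Config (start M) 0 x zeros zeros.

(** A left move on the leftmost cell leaves the head in place. *)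
Definition move (d : direction) (n : nat) : nat :=
  match d with Left => n.-1 | Right => n.+1 end.

Definition halted (M : ittm) (c : config M) : bool := cstate c == halt M.

Definition step (M : ittm) (c : config M) : config M :=
  if halted c then c else
  let n := head c in
  let: (q, (u, v, w), d) := delta (cstate c) (tin c n, tscr c n, tout c n) in
  Config q (move d n) [eta tin c with n |-> u] [eta tscr c with n |-> v]
         [eta tout c with n |-> w].

(** Stages of a computation are the elements of a set [W] well-ordered by the
    (reflexive) relation [R]; any ordinal can be taken for [W]. *)
Section Stages.
Variables (W : Type) (R : rel W).

Definition before (b a : W) : Prop := ~~ R a b.

Definition is_first (a : W) : Prop := forall b, R a b.

Definition is_succ (b a : W) : Prop :=
  before b a /\ forall g, before g a -> R g b.

Definition is_limit (a : W) : Prop :=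
  (exists b, before b a) /\ forall b, before b a -> exists2 g, before b g & before g a.

(** [v] is the limsup, for [false < true], of the values of [f] before [a]. *)
Definition is_limsup (f : W -> bool) (a : W) (v : bool) : Prop :=
  v <-> forall b, before b a -> exists2 g, R b g & before g a /\ f g.

Record run (M : ittm) (x : real) (c : W -> config M) : Prop := Run {
  run_first : forall a, is_first a -> c a = initial M x;
  run_succ : forall a b, is_succ b a -> c a = step (c b);
  run_limit : forall a, is_limit a ->
    [/\ cstate (c a) = limit M, head (c a) = 0 &
        forall n, [/\ is_limsup (fun g => tin (c g) n) a (tin (c a) n),
                      is_limsup (fun g => tscr (c g) n) a (tscr (c a) n) &
                      is_limsup (fun g => tout (c g) n) a (tout (c a) n)]]
}.

End Stages.

(** Only the first halting stage counts: a run is also defined on the stages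
    following it, where it is meaningless. *)
Definition outputs (M : ittm) (x y : real) : Prop :=
  exists (W : Type) (R : rel W) (c : W -> config M) (a : W),
    [/\ well_order R, run R x c, halted (c a),
        (forall b, before R b a -> ~~ halted (c b)) & tout (c a) = y].

(** Natural numbers as reals: the characteristic sequence of [{0, ..., n - 1}]. *)
Definition natcode (n : nat) : real := fun m => m < n.

Definition ittm_decidable (S : set real) : Prop :=
  exists M, forall x, outputs M x (natcode (x \in S)).

(** A list of [k] reals as a real: [1^k 0], then the bits of index 0 of the [k]
    reals, then their bits of index 1, etc. *)
Definition seqcode (s : seq real) : real := fun m =>
  let k := size s in
  if m < k then true else
  if m == k then false else
  nth zeros s ((m - k.+1) %% k) ((m - k.+1) %/ k).

Record language := Language {
  relsym : Type;
  funsym : Type;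
  cstsym : Type;
  relar : relsym -> nat;
  funar : funsym -> nat
}.

Inductive symbol (L : language) :=
  | SRel of relsym L
  | SFun of funsym L
  | SCst of cstsym L.

Definition kind (L : language) (s : symbol L) : nat :=
  match s with SRel _ => 0 | SFun _ => 1 | SCst _ => 2 end.

Definition arity (L : language) (s : symbol L) : nat :=
  match s with SRel r => relar r | SFun f => funar f | SCst _ => 0 end.

Record computable_language := ComputableLanguage {
  lang :> language;
  gcode : symbol lang -> real;
  gcode_inj : injective gcode;
  gcode_decidable : ittm_decidable [set x | exists s, gcode s = x];
  kind_computable :
    exists M, forall s : symbol lang, outputs M (gcode s) (natcode (kind s));
  arity_computable :
    exists M, forall s : symbol lang, outputs M (gcode s) (natcode (arity s))
}.

Definition purely_relational (L : language) : Prop :=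
  (funsym L -> False) /\ (cstsym L -> False).

Definition relational_plus_unary_function (L : language) : Prop :=
  (exists f : funsym L, funar f = 1 /\ forall g, g = f) /\ (cstsym L -> False).

Record structure (L : language) (D : Type) := Structure {
  rel_interp : forall r : relsym L, (relar r).-tuple D -> Prop;
  fun_interp : forall f : funsym L, (funar f).-tuple D -> D;
  cst_interp : cstsym L -> D
}.

Definition isomorphic (L : language) (D D' : Type)
    (A : structure L D) (B : structure L D') : Prop :=
  exists h : D -> D',
    [/\ bijective h,
        forall r a, rel_interp A (r := r) a <-> rel_interp B (map_tuple h a),
        forall f a, h (fun_interp A (f := f) a) = fun_interp B (map_tuple h a) &
        forall k, h (cst_interp A k) = cst_interp B k].

Inductive term (L : language) (D : Type) :=
  | Var of nat
  | Par of D
  | Cst of cstsym L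
  | App (f : funsym L) of ('I_(funar f) -> term L D).

Inductive formula (L : language) (D : Type) :=
  | Eq of term L D & term L D
  | Rel (r : relsym L) of ('I_(relar r) -> term L D)
  | Neg of formula L D
  | And of formula L D & formula L D
  | Or of formula L D & formula L D
  | Imp of formula L D & formula L D
  | All of nat & formula L D
  | Ex of nat & formula L D.

Arguments Var {L D}.
Arguments Par {L D}.
Arguments Cst {L D}.

Section Semantics.
Variables (L : language) (D : Type) (A : structure L D).

Fixpoint eval (e : nat -> D) (t : term L D) : D :=
  match t with
  | Var i => e i
  | Par a => a
  | Cst k => cst_interp A k
  | App f ts => fun_interp A (mktuple (fun i => eval e (ts i)))
  end.

Fixpoint sat (e : nat -> D) (p : formula L D) : Prop :=
  match p with
  | Eq t u => eval e t = eval e u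
  | Rel r ts => rel_interp A (mktuple (fun i => eval e (ts i)))
  | Neg q => ~ sat e q
  | And q r => sat e q /\ sat e r
  | Or q r => sat e q \/ sat e r
  | Imp q r => sat e q -> sat e r
  | All i q => forall a, sat [eta e with i |-> a] q
  | Ex i q => exists a, sat [eta e with i |-> a] q
  end.

Fixpoint tclosed (bound : seq nat) (t : term L D) : Prop :=
  match t with
  | Var i => i \in bound
  | Par _ | Cst _ => True
  | App f ts => forall i, tclosed bound (ts i)
  end.

Fixpoint fclosed (bound : seq nat) (p : formula L D) : Prop :=
  match p with
  | Eq t u => tclosed bound t /\ tclosed bound u
  | Rel r ts => forall i, tclosed bound (ts i)
  | Neg q => fclosed bound q
  | And q r | Or q r | Imp q r => fclosed bound q /\ fclosed bound r
  | All i q | Ex i q => fclosed (i :: bound) q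
  end.

(** All free variables have been replaced by parameters. *)
Definition sentence (p : formula L D) : Prop := fclosed [::] p.

Definition models (p : formula L D) : Prop := forall e, sat e p.

End Semantics.

(** Formulas are written as words in Polish notation over logical symbols,
    which are natural numbers, symbols of the language, and parameters. *)
Inductive letter (L : language) (D : Type) :=
  | Logical of nat
  | Sym of symbol L
  | Param of D.

Arguments Logical {L D}.
Arguments Sym {L D}.
Arguments Param {L D}.

Section Words.
Variables (L : language) (D : Type).

Fixpoint tword (t : term L D) : seq (letter L D) :=
  match t with
  | Var i => [:: Logical (7 + i)]
  | Par a => [:: Param a]
  | Cst k => [:: Sym (SCst k)]
  | App f ts =>
      Sym (SFun f) :: flatten [seq tword (ts i) | i <- enum 'I_(funar f)]
  end.

Fixpoint fword (p : formula L D) : seq (letter L D) :=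
  match p with
  | Eq t u => Logical 0 :: tword t ++ tword u
  | Rel r ts =>
      Sym (SRel r) :: flatten [seq tword (ts i) | i <- enum 'I_(relar r)]
  | Neg q => Logical 1 :: fword q
  | And q r => Logical 2 :: fword q ++ fword r
  | Or q r => Logical 3 :: fword q ++ fword r
  | Imp q r => Logical 4 :: fword q ++ fword r
  | All i q => [:: Logical 5, Logical (7 + i) & fword q]
  | Ex i q => [:: Logical 6, Logical (7 + i) & fword q]
  end.

End Words.

(** A (nonempty) structure whose universe is a set of reals. *)
Record real_model (L : language) := RealModel {
  dom : set real;
  dom_nonempty : dom !=set0;
  str :> structure L dom
}.

Definition bcons (b : bool) (x : real) : real :=
  fun n => if n is m.+1 then x m else b.

Section Models.
Variables (L : computable_language) (A : real_model L).

(** Two bits distinguish the three sorts of letters. *)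
Definition lettercode (l : letter L (dom A)) : real :=
  match l with
  | Logical n => bcons false (bcons false (natcode n))
  | Sym s => bcons false (bcons true (gcode s))
  | Param a => bcons true (bcons false (sval a))
  end.

Definition formulacode (p : formula L (dom A)) : real :=
  seqcode (map lettercode (fword p)).

Definition elementary_diagram : set real :=
  [set x | exists p, [/\ sentence p, models A p & formulacode p = x]].

Definition decidable_model : Prop :=
  ittm_decidable (dom A) /\ ittm_decidable elementary_diagram.

Definition inputcode (s : symbol L) (a : seq (dom A)) : real :=
  seqcode (gcode s :: map (fun u => sval u) a).

(** Uniformity: one machine serves all the symbols of a given kind. *)
Definition computable_model : Prop :=
  [/\ ittm_decidable (dom A),
      exists M, forall (r : relsym L) (a : (relar r).-tuple (dom A)),
        outputs M (inputcode (SRel r) a) (natcode `[< rel_interp A a >]),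
      exists M, forall (f : funsym L) (a : (funar f).-tuple (dom A)),
        outputs M (inputcode (SFun f) a) (sval (fun_interp A a)) &
      exists M, forall k : cstsym L,
        outputs M (inputcode (SCst k) [::]) (sval (cst_interp A k))].

End Models.

Definition has_computable_presentation (L : computable_language) (D : Type)
    (S : structure L D) : Prop :=
  exists B : real_model L, computable_model B /\ isomorphic S B.

(* Main.v *)
From HB Require Import structures.
From mathcomp Require Import all_boot zify.
From mathcomp Require Import boolp classical_sets wochoice.
Require Import Defs.

(** In a purely relational language the model is its own presentation: an
    instance of a relation is decided by rewriting the input into the code of an
    atomic sentence and running the machine for the elementary diagram.

    With a unary function [f] the value [f a] need not be computable from [a].
    The presentation therefore replaces [a] by a real coding the whole orbit
    [a, f a, f (f a), ...], so that [f] becomes a shift.  Such codes are decided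
    by testing, for each of the [omega] many indices, whether the sentence
    [f a_i = a_{i+1}] belongs to the diagram.  As the code of the symbol [f] may
    be recognizable without being writable, it is interleaved with the orbit;
    the same tests then certify it. *)

Set Implicit Arguments.
Unset Strict Implicit.
Unset Printing Implicit Defensive.

Local Open Scope classical_set_scope.

(** * Machines with finitely many tracks *)

(** The diagram answers questions about given reals but does not find the real [b] with [f a = b]:
    that would be a search through all reals. Hence values have to be stored in the input, and a
    store closed under [f] must contain the whole orbit; for one unary function this is a sequence
    of length omega and fits into one real. The element [a] stays readable at fixed positions, so
    relations are still decided by the original diagram. Neighbouring tests share the element stored
    between them, and therefore force the stored sequence to be an orbit.

    Most of the work is the construction of concrete machines. Runs are indexed by arbitrary
    well-orders, so they are cut into segments that can be added along a well-order, and machines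
    may have any finite number of tracks until one compilation brings them to three tapes. The
    recurring obstacle is the limsup rule: auxiliary bits must not show up cofinally in a cell that
    matters, and after a limit stage the machine must recover from its tapes which phase it was
    in. *)

Section WellOrder.
Variables (W : Type) (R : rel W).
Hypothesis Rwo : well_order R.

(** [well_order] gives unique least elements for Boolean predicates. This form serves arbitrary
    properties; the order axioms then come from sets of at most three elements, antisymmetry from
    the uniqueness. *)
Lemma wo_min (P : W -> Prop) :
  (exists x, P x) -> exists2 z, P z & forall x, P x -> R z x.
Proof.
move=> [x Px].
have [|z [[Az zmin] _]] := Rwo (A := [pred y | `[<P y>]]).
  by exists x; rewrite inE.
exists z; first by move: Az; rewrite inE.
by move=> y Py; apply: zmin; rewrite inE.
Qed.

Lemma wo_refl x : R x x.
Proof. by have [|z -> ->] := wo_min (P := fun y => y = x); first by exists x. Qed.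

Lemma wo_total x y : R x y \/ R y x.
Proof.
have [|z [->|->] zmin] := wo_min (P := fun z => z = x \/ z = y).
- by exists x; left.
- by left; apply: zmin; right.
- by right; apply: zmin; left.
Qed.

Lemma wo_anti x y : R x y -> R y x -> x = y.
Proof.
move=> xy yx.
have [|z [_ zmin]] := Rwo (A := [pred z | `[<z = x \/ z = y>]]).
  by exists x; rewrite inE; left.
have zx : z = x.
  apply: zmin; split; first by rewrite inE; left.
  by move=> t; rewrite inE => -[->|->] //; apply: wo_refl.
have zy : z = y.
  apply: zmin; split; first by rewrite inE; right.
  by move=> t; rewrite inE => -[->|->] //; apply: wo_refl.
by rewrite -zx.
Qed.

Lemma wo_trans y x z : R x y -> R y z -> R x z.
Proof.
move=> xy yz.
have [|t Pt tmin] := wo_min (P := fun t => [\/ t = x, t = y | t = z]).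
  by exists x; constructor 1.
have tx : R t x by apply: tmin; constructor 1.
have ty : R t y by apply: tmin; constructor 2.
have tz : R t z by apply: tmin; constructor 3.
case: Pt => [<- //|ey|ez].
- by rewrite (wo_anti xy) // -ey.
- by rewrite -(wo_anti (y := z) yz) // -ez.
Qed.

Lemma wo_ltW x y : ~~ R y x -> R x y.
Proof. by case: (wo_total x y) => // ->. Qed.

Lemma wo_lt_le y x z : ~~ R y x -> R y z -> ~~ R z x.
Proof. by move=> yx yz; apply: contra yx; apply: wo_trans. Qed.

Lemma wo_eq_or_lt x y : R x y -> x = y \/ ~~ R y x.
Proof.
by move=> xy; case yx: (R y x); [left; apply: wo_anti | right].
Qed.

End WellOrder.

Lemma well_order_intro (W : Type) (R : rel W) :
  (forall x y, R x y -> R y x -> x = y) ->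
  (forall P : W -> Prop, (exists x, P x) ->
     exists2 z, P z & forall x, P x -> R z x) -> well_order R.
Proof.
move=> Ranti Rmin; apply: antisymmetric_well_order.
  by move=> x y /andP[]; apply: Ranti.
move=> A [x Ax]; have [|z Az zmin] := Rmin (fun y => y \in A); first by exists x.
by exists z; split.
Qed.

(** * Multi-track machines and half-open segments of their runs *)

Record gm := GM {
  trk : finType;
  gst : finType;
  gstart : gst;
  glim : gst;
  ghalt : gst;
  gdelta : gst -> (trk -> bool) -> gst * (trk -> bool) * direction
}.

Section Segments.
Variable G : gm.

Record conf := Conf { st : gst G; hd : nat; tp : trk G -> real }.

Definition gstep (c : conf) : conf :=
  let: (q, w, d) := gdelta (st c) (fun k => tp c k (hd c)) in
  Conf q (move d (hd c)) (fun k p => if p == hd c then w k else tp c k p).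

(** [d] is the configuration forced on the stage following the stages in [P]:
    the stage [m] leads to [e m] and visits the configurations in [H m]. *)
Definition lands (V : Type) (R : rel V) (e : V -> conf) (H : V -> set conf)
    (P : V -> Prop) (c d : conf) : Prop :=
  [/\ (forall a, ~ P a) -> d = c,
      forall m, P m -> (forall a, P a -> R a m) -> d = e m &
      (exists a, P a) -> (forall a, P a -> exists2 b, P b & ~~ R b a) ->
      [/\ st d = glim G, hd d = 0 &
          forall k p, tp d k p <->
            forall b, P b -> exists g, [/\ P g, R b g & exists2 h, H g h & tp h k p]]].

Record course := Course { len : Type; ord : rel len; pos : len -> conf }.

Definition plands (Q : course) : (len Q -> Prop) -> conf -> conf -> Prop :=
  lands (@ord Q) (fun b => gstep (pos b)) (fun b => [set pos b]).

(** Half-open: the stages start from [c], while [d] is forced after all of them and is not one of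
    them. So only [d] may be halting, and courses can be put end to end. *)
Definition valid (c d : conf) (Q : course) : Prop :=
  [/\ well_order (@ord Q),
      forall a : len Q, plands (before (@ord Q) ^~ a) c (pos a),
      plands (fun _ : len Q => True) c d &
      forall a : len Q, st (pos a) != ghalt G].

(** The length is hidden; the set [H] of visited configurations is what a later limsup needs to
    know. *)
Definition seg (H : set conf) (c d : conf) : Prop :=
  exists2 Q, valid c d Q & forall h, H h <-> exists a : len Q, pos a = h.

End Segments.

Arguments lands {G V} R e H P c d.
Arguments plands {G} Q P c d.

Lemma existT_inj (V : Type) (F : V -> Type) v (x y : F v) :
  existT F v x = existT F v y -> x = y.
Proof.
move=> E; have := projT2_eq E; rewrite /=.
by rewrite (Prop_irrelevance (projT1_eq E) (erefl v)).
Qed.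

Lemma lands_ext (G : gm) (V : Type) (R : rel V) e (H : V -> set (conf G)) P P' c d :
  (forall a, P a <-> P' a) -> lands R e H P c d -> lands R e H P' c d.
Proof. by move=> PP'; suff -> : P = P' by []; apply/funext => a; apply/propext. Qed.

(** * Concatenation of segments along a well-order *)

Section Sum.
Variables (G : gm) (V : Type) (R : rel V) (d e : V -> conf G) (H : V -> set (conf G)).
Variable c : conf G.
Hypothesis Rwo : well_order R.
Variable Q : V -> course G.
Hypothesis Qv : forall v, valid (d v) (e v) (Q v).
Hypothesis QH : forall v h, H v h <-> exists a : len (Q v), pos a = h.
Hypothesis H_ne : forall v, exists h, H v h.

Let W := {v : V & len (Q v)}.
Let mk v (x : len (Q v)) : W := existT (fun v => len (Q v)) v x.

Definition lex (p q : W) : Prop :=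
  ~~ R (tag q) (tag p) \/
  exists v (x y : len (Q v)), [/\ p = mk x, q = mk y & ord x y].

Let L : rel W := fun p q => `[<lex p q>].
Let r (p : W) : conf G := pos (tagged p).

Lemma fiber_ex v : exists x : len (Q v), True.
Proof. by have [h /QH [x _]] := H_ne v; exists x. Qed.

Lemma lex_same v (x y : len (Q v)) : L (mk x) (mk y) <-> ord x y.
Proof.
split=> [/asboolP|xy]; last by apply/asboolP; right; exists v, x, y.
case=> [|[u [x' [y' [E1 E2 xy]]]]]; first by rewrite /= (wo_refl Rwo).
have uv : v = u by case: E1.
by subst u; rewrite (existT_inj E1) (existT_inj E2).
Qed.

Lemma lex_lt u v (x : len (Q u)) (y : len (Q v)) : ~~ R v u -> L (mk x) (mk y).
Proof. by move=> uv; apply/asboolP; left. Qed.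

Lemma lex_tag p q : L p q -> R (tag p) (tag q).
Proof.
case/asboolP=> [/(wo_ltW Rwo) //|[v [x [y [-> -> _]]]]] /=.
exact: (wo_refl Rwo).
Qed.

Lemma lex_wo : well_order L.
Proof.
apply: well_order_intro => [[u x] [v y] xy yx|P [[v0 x0] P0]].
  have uv : u = v by apply: (wo_anti Rwo); [exact: (lex_tag xy)|exact: (lex_tag yx)].
  subst v; move/lex_same: xy => xy; move/lex_same: yx => yx.
  by have [wo _ _ _] := Qv u; rewrite (wo_anti wo xy yx).
have [|v [x Px] vmin] := wo_min Rwo (P := fun v => exists x, P (@mk v x)).
  by exists v0, x0.
have [wo _ _ _] := Qv v.
have [|y Py ymin] := wo_min wo (P := fun x => P (mk x)); first by exists x.
exists (mk y) => // -[u z] Pz.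
have vu : R v u by apply: vmin; exists z.
have [E|lt] := wo_eq_or_lt Rwo vu; last exact: lex_lt.
by subst u; apply/lex_same/ymin.
Qed.

Let slands := lands L (fun p => gstep (r p)) (fun p => [set r p]).

(** The cut [P'] ends inside the fibre [v]. Maxima, limits and limsups depend on a final part only,
    so for [P'] they are those of [P] in the course [Q v]. *)
Lemma lands_tail v (P : len (Q v) -> Prop) (P' : W -> Prop) c1 c2 z :
  (exists x, P x) -> (forall x, P' (mk x) <-> P x) ->
  (forall u x, P' (@mk u x) -> R u v) ->
  plands (Q v) P c1 z -> slands P' c2 z.
Proof.
move=> [x0 Px0] P'P P'v [_ lmax llim]; have [wo _ _ _] := Qv v; split.
- by move=> /(_ (mk x0)) []; apply/P'P.
- move=> [u x] P'm mmax.
  have vu : R v u by have := mmax (mk x0); rewrite P'P => /(_ Px0)/lex_tag.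
  have uv := wo_anti Rwo vu (P'v _ _ P'm).
  subst u; move/P'P: P'm => Px; apply: lmax => // a Pa.
  by apply/lex_same/mmax/P'P.
- move=> _ unb.
  have [|a Pa|-> -> lim] := llim; first by exists x0.
    have [|[u b] P'b ba] := unb (mk a); first exact/P'P.
    have vu : R v u by apply: contraNT ba => /lex_lt.
    have uv := wo_anti Rwo vu (P'v _ _ P'b).
    subst u; exists b; first exact/P'P.
    by apply: contra ba => /lex_same.
  split=> // k p; rewrite lim; split=> limp.
    move=> [u b] P'b; have [E|lt] := wo_eq_or_lt Rwo (P'v _ _ P'b).
      subst u; move/P'P: P'b => Pb.
      have [g [Pg bg [h -> hk]]] := limp _ Pb.
      by exists (mk g); split; [exact/P'P|exact/lex_same|exists (pos g)].
    have [g [Pg _ [h -> hk]]] := limp _ Px0.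
    by exists (mk g); split; [exact/P'P|exact/lex_lt|exists (pos g)].
  move=> b Pb; have [|[u g] [P'g bg [h -> hk]]] := limp (mk b); first exact/P'P.
  have uv := wo_anti Rwo (lex_tag bg) (P'v _ _ P'g).
  rewrite /= in uv; subst u; move/P'P: P'g => Pg; move/lex_same: bg => bg.
  by exists g; split=> //; exists (pos g).
Qed.

(** If there is a last fibre, the end of its course decides. Otherwise the union is a limit in the
    sum as well, because every fibre is inhabited. *)
Lemma lands_fibers (P : V -> Prop) z :
  lands R e H P c z -> slands (fun p => P (tag p)) c z.
Proof.
move=> [lemp lmax llim].
have [[m Pm mmax]|nomax] := pselect (exists2 m, P m & forall a, P a -> R a m).
  have [_ _ Qe _] := Qv m; rewrite (lmax m) //.
  apply: (@lands_tail m (fun=> True) _ (d m) c) => //; first exact: fiber_ex.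
  by move=> u x /= /mmax.
split.
- move=> Pemp; apply: lemp => a Pa; have [x _] := fiber_ex a.
  exact: (Pemp (mk x)).
- move=> [u x] Pu umax; case: nomax; exists u => // a Pa; have [y _] := fiber_ex a.
  exact: (lex_tag (umax (mk y) Pa)).
move=> [[u x] Pu] _.
have unb a : P a -> exists2 b, P b & ~~ R b a.
  move=> Pa; apply: contrapT => nob; case: nomax; exists a => // b Pb.
  by apply: contrapT => /negP ba; case: nob; exists b.
have [||-> -> lim] := llim; [by exists u|by []|split=> // k p; rewrite lim; split=> limp].
  move=> [a y] Pa; have [b Pb ab] := unb _ Pa.
  have [g [Pg bg [h Hh hk]]] := limp _ Pb.
  have [y' hy] := (QH g h).1 Hh.
  exists (mk y'); split=> //; last by exists h.
  exact/lex_lt/(wo_lt_le Rwo ab).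
move=> b Pb; have [y _] := fiber_ex b.
have [[g y'] [Pg bg [h -> hk]]] := limp (mk y) Pb.
exists g; split=> //; first exact: (lex_tag bg).
by exists (r (existT _ g y')) => //; apply/QH; exists y'.
Qed.

Lemma sum_valid z :
  (forall v, lands R e H (before R ^~ v) c (d v)) ->
  lands R e H (fun=> True) c z ->
  valid c z (Course L r).
Proof.
move=> dl zl; split.
- exact: lex_wo.
- move=> [v w]; have [wo Qs _ _] := Qv v; rewrite /plands /=.
  (* A stage that is not the first of its fibre is reached inside the fibre; a first stage is
     reached from the union of the earlier fibres. *)
  have [[x xw]|nox] := pselect (exists x, before (@ord _ (Q v)) x w).
    apply: (@lands_tail v _ (before L ^~ (mk w)) (d v) c _ _ _ _ (Qs w)).
    - by exists x.
    - by move=> y; rewrite /before; split; apply: contra => /lex_same.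
    - by move=> u y; apply: contraNT => /lex_lt; apply.
  have -> : r (existT _ v w) = d v.
    by have [+ _ _] := Qs w; apply=> a aw; apply: nox; exists a.
  apply: lands_ext (lands_fibers (dl v)) => -[u x]; rewrite /before /=; split.
    by move=> uv; apply: contra uv => /lex_tag.
  move=> xw; apply/negP => vu; case: (wo_eq_or_lt Rwo vu) => [E|lt]; last first.
    by case/negP: xw; apply: lex_lt.
  subst u; apply: nox; exists x.
  by apply: contra xw => /lex_same.
- exact: lands_fibers zl.
- by move=> [v w]; have [_ _ _] := Qv v; apply.
Qed.

End Sum.

Lemma seg_sum (G : gm) (V : Type) (R : rel V) (d e : V -> conf G)
    (H : V -> set (conf G)) (c z : conf G) :
  well_order R -> (forall v, seg (H v) (d v) (e v)) ->
  (forall v, exists h, H v h) ->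
  (forall v, lands R e H (before R ^~ v) c (d v)) ->
  lands R e H (fun=> True) c z ->
  seg (fun h => exists v, H v h) c z.
Proof.
move=> Rwo segs ne dl zl.
have [v|Q Qv] := @choice V (course G) (fun v Q => valid (d v) (e v) Q /\
    forall h, H v h <-> exists a : len Q, pos a = h).
  by have [Q] := segs v; exists Q.
have Q1 v := (Qv v).1; have Q2 v := (Qv v).2.
exists (Course (fun p q => `[<lex R p q>]) (fun p : {v : V & len (Q v)} => pos (tagged p))).
  exact: (sum_valid Rwo Q1 Q2 ne dl zl).
move=> h; split=> [[v /Q2 [a <-]]|[[v a] <-]]; first by exists (existT _ v a).
by exists v; apply/Q2; exists a.
Qed.

Lemma seg_ext (G : gm) (H H' : set (conf G)) c d :
  (forall h, H h <-> H' h) -> seg H c d -> seg H' c d.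
Proof. by move=> HH [Q Qv QH]; exists Q => // h; rewrite -HH. Qed.

Lemma seg_refl (G : gm) (c : conf G) : seg set0 c c.
Proof.
exists (Course (fun _ _ : False => true) (fun x : False => match x with end)).
  split=> //=; first by apply: well_order_intro => [[]|P [[]]].
  by split=> [//|[]//|[[]]].
by move=> h; split=> [//|[[]]].
Qed.

Lemma seg_step (G : gm) (c : conf G) :
  st c != ghalt G -> seg [set c] c (gstep c).
Proof.
move=> ch; exists (Course (fun _ _ : unit => true) (fun _ => c)).
  split=> //=.
  - by apply: well_order_intro => [[] []|P [[] P0]] //; exists tt => // -[].
  - by move=> a; split=> [//|m /negP//|[x /negP//]].
  - by split=> [/(_ tt)//|//|_ /(_ tt I)[]].
by move=> h; split=> [->|[_ <-]//]; exists tt.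
Qed.

Lemma seg_first (G : gm) (H : set (conf G)) c d :
  seg H c d -> (exists h, H h) -> H c.
Proof.
move=> [Q [wo Qs _ _] QH] [h /QH [a _]]; apply/QH.
have [|z _ zmin] := wo_min wo (P := fun=> True); first by exists a.
exists z; have [+ _ _] := Qs z; apply=> b; rewrite /before.
by rewrite (zmin b I).
Qed.

Lemma seg_empty (G : gm) (H : set (conf G)) c d :
  seg H c d -> (forall h, ~ H h) -> c = d.
Proof.
move=> [Q [_ _ [de _ _] _] QH] Hemp; apply/esym/de => a _.
by apply: (Hemp (pos a)); apply/QH; exists a.
Qed.

Lemma well_order_bool : well_order implb.
Proof.
apply: well_order_intro => [[] []//|P [x Px]].
have [Pf|nPf] := pselect (P false); first by exists false.
exists true; first by case: x Px.
by case.
Qed.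

Lemma seg_trans (G : gm) (H1 H2 : set (conf G)) c1 c2 c3 :
  seg H1 c1 c2 -> seg H2 c2 c3 -> seg (H1 `|` H2) c1 c3.
Proof.
move=> s1 s2.
(* [seg_sum] wants inhabited fibres, so an empty segment, whose ends coincide, is treated apart. *)
have [ne1|/forallNP e1] := pselect (exists h, H1 h); last first.
  rewrite (seg_empty s1 e1); apply: seg_ext s2 => h.
  by split=> [|[/e1//|//]]; right.
have [ne2|/forallNP e2] := pselect (exists h, H2 h); last first.
  rewrite -(seg_empty s2 e2); apply: seg_ext s1 => h.
  by split=> [|[//|/e2//]]; left.
have bf a b : before implb b a -> b = false /\ a = true by case: a b => -[].
apply: (@seg_ext _ (fun h => exists b : bool, (if b then H2 else H1) h)).
  by move=> h; split=> [[[] ?]|[]]; [right|left|exists false|exists true].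
apply: (@seg_sum _ _ implb (fun b : bool => if b then c2 else c1)
    (fun b : bool => if b then c3 else c2)).
- exact: well_order_bool.
- by case.
- by case.
- case; split=> //.
  + by move=> /(_ false)[].
  + by move=> m /bf[] ->.
  + by move=> _ /(_ false isT)[b bb]; have [->] := bf _ _ bb.
  + by move=> [b bb]; have [] := bf _ _ bb.
- split=> //; first by move=> /(_ true)[].
  + by case=> // _ /(_ true I).
  + by move=> _ /(_ true I) [[]].
Qed.

Lemma well_order_nat : well_order leq.
Proof.
apply: well_order_intro => [x y xy yx|P [x Px]].
  by apply/eqP; rewrite eqn_leq xy.
have ex : exists n, `[< P n >] by exists x; apply/asboolP.
by case: (ex_minnP ex) => m /asboolP Pm mmin; exists m => // y /asboolP /mmin.
Qed.

(** [Good] records about the [n]-th block whatever is later needed to evaluate the limsup. Each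
    block must visit something, since otherwise no limit stage need arise. *)
Lemma seg_omega (G : gm) (Inv : nat -> conf G -> Prop)
    (Good : nat -> set (conf G) -> Prop) c :
  Inv 0 c ->
  (forall n c, Inv n c -> exists H d,
     [/\ seg H c d, exists h, H h, Good n H & Inv n.+1 d]) ->
  exists (H : nat -> set (conf G)) t,
    [/\ forall n, Good n (H n),
        seg (fun h => exists n, H n h) c (Conf (glim G) 0 t) &
        forall k p, t k p <-> forall N, exists n h, [/\ N <= n, H n h & tp h k p]].
Proof.
move=> I0 IS.
(* Successors are chosen for all pairs at once, so that [d] can be defined by plain recursion and
   the invariant proved afterwards. *)
have [[n e]|p Pp] := @choice (nat * conf G) (set (conf G) * conf G) (fun nc hd =>
    Inv nc.1 nc.2 -> [/\ seg hd.1 nc.2 hd.2, exists h, hd.1 h,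
      Good nc.1 hd.1 & Inv nc.1.+1 hd.2]).
  have [/IS [H [d HP]]|ni] := pselect (Inv n e); first by exists (H, d).
  by exists (set0, c) => /ni.
pose d := fix d n := if n is m.+1 then (p (m, d m)).2 else c.
have Id n : Inv n (d n) by elim: n => //= n /(Pp (n, _))[].
pose H n := (p (n, d n)).1.
pose t k x : bool := `[< forall N, exists n h, [/\ N <= n, H n h & tp h k x] >].
exists H, t; split.
- by move=> n; have [] := Pp (n, d n) (Id n).
- apply: (@seg_sum _ _ leq d (fun n => d n.+1) H).
  + exact: well_order_nat.
  + by move=> n; have [] := Pp (n, d n) (Id n).
  + by move=> n; have [] := Pp (n, d n) (Id n).
  + move=> n; rewrite /before; split.
    * by case: n => // n /(_ n); rewrite ltnn.
    * case: n => // n m; rewrite -ltnNge ltnS => mn /(_ n); rewrite ltnn => /(_ isT) nm.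
      by have -> : m = n by apply/eqP; rewrite eqn_leq mn.
    * move=> [m]; case: n => // n mn /(_ n); rewrite ltnn => /(_ isT) [b].
      by rewrite -!ltnNge ltnS; case: leqP.
  + split=> //; first by move=> /(_ 0).
      by move=> m _ /(_ m.+1 I); rewrite ltnn.
    move=> _ _; split=> // k x; split.
      by move=> /asboolP tk b _; have [n [h [bn Hh hk]]] := tk b; exists n; split=> //; exists h.
    move=> tk; apply/asboolP => N; have [n [_ Nn [h Hh hk]]] := tk N I.
    by exists n, h.
- by move=> k x; split=> /asboolP.
Qed.

Lemma bool_iff_eq (a b : bool) : (a <-> b) -> a = b.
Proof. by case: a b => -[] // [] => [/(_ isT)|_ /(_ isT)]. Qed.

(** The limit tapes of the sweeping machines below are computed this way: every cell is final from
    some block on. *)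
Lemma limsup_eventually (G : gm) (H : nat -> set (conf G)) (b v : bool) k p N :
  (b <-> forall N, exists n h, [/\ N <= n, H n h & tp h k p]) ->
  (forall n, exists h, H n h) ->
  (forall n h, N <= n -> H n h -> tp h k p = v) -> b = v.
Proof.
move=> bE ne ev; apply: bool_iff_eq; rewrite bE; split.
  by move=> /(_ N) [n [h [Nn Hh]]]; rewrite (ev n h Nn Hh).
move=> vt M; have [h Hh] := ne (maxn M N); exists (maxn M N), h.
by rewrite leq_maxl (ev _ _ (leq_maxr M N) Hh).
Qed.

Section Walk.
Variables (G : gm) (I : set (conf G)).

(** [I] is asked of the configurations that are left, not of the last one, in accordance with
    half-open segments. *)
Inductive walk : conf G -> conf G -> Prop :=
  | walk0 c : walk c c
  | walkS c d : I c -> st c != ghalt G -> walk (gstep c) d -> walk c d.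

Lemma walk_trans c2 c1 c3 : walk c1 c2 -> walk c2 c3 -> walk c1 c3.
Proof. by elim=> // c d Ic hc _ IH /IH; apply: walkS. Qed.

Lemma walk_seg c d : walk c d -> exists2 H, seg H c d & H `<=` I.
Proof.
elim=> [e|c1 d1 Ic hc _ [H sH HI]]; first by exists set0 => //; apply: seg_refl.
exists ([set c1] `|` H); first exact: seg_trans (seg_step hc) sH.
by move=> h [->|/HI].
Qed.

Lemma walk_seg1 c d : I c -> st c != ghalt G -> walk (gstep c) d ->
  exists H, [/\ seg H c d, exists h, H h & H `<=` I].
Proof.
move=> Ic hc /walk_seg [H sH HI]; exists ([set c] `|` H); split.
- exact: seg_trans (seg_step hc) sH.
- by exists c; left.
- by move=> h [->|/HI].
Qed.

End Walk.

(** Simulation of [G1] by [G2]: a limit stage of [G1] is simulated by a limit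
    stage of [G2] followed by a further computation (hypothesis [sim_lim]). *)
Section Simulation.
Variables (G1 G2 : gm) (f : conf G1 -> conf G2).
Hypothesis f_tape : forall k2 p2,
  (exists k p, forall c, tp (f c) k2 p2 = tp c k p) \/
  (exists b, forall c, tp (f c) k2 p2 = b).
Hypothesis sim_step : forall c, st c != ghalt G1 ->
  exists H, [/\ seg H (f c) (f (gstep c)), exists h, H h &
    forall h, H h -> forall k p,
      tp h k p = tp (f c) k p \/ tp h k p = tp (f (gstep c)) k p].
Hypothesis sim_lim : forall c, st c = glim G1 -> hd c = 0 ->
  exists2 H, seg H (Conf (glim G2) 0 (tp (f c))) (f c) &
    forall h, H h -> tp h = tp (f c).

(** Each cell of [f c] is a copy of a cell or a constant, and intermediate configurations show in it
    only the value before or after the simulated step. Hence limsups over simulating stages agree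
    with those over simulated stages. *)
Lemma simulation H c d : seg H c d -> exists H', seg H' (f c) (f d).
Proof.
move=> [Q [wo Qs Qe Qh] _].
pose islim (P : len Q -> Prop) :=
  (exists a, P a) /\ forall a, P a -> exists2 b, P b & ~~ ord b a.
(* At a limit cut, [G2] has just entered its limit state and has yet to reach [f e]. [D] is where
   the simulating run lands before this repair. *)
pose D P e := if pselect (islim P) then Conf (glim G2) 0 (tp (f e)) else f e.
have DL (P : len Q -> Prop) e (Pd : forall a b, P b -> ord a b -> P a) : plands Q P c e ->
    exists2 H, seg H (D P e) (f e) & forall h, H h -> tp h = tp (f e).
  move=> [_ _ lime]; rewrite /D; case: pselect => [[ne unb]|nl] /=; last first.
    by exists set0; first exact: seg_refl.
  by have [se he _] := lime ne unb; apply: sim_lim.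
pose B a := before (@ord _ Q) ^~ a.
have Bd a x y : B a y -> ord x y -> B a x.
  by move=> ya xy; apply: contra ya => /(wo_trans wo); apply.
have [v|H' H'P] := @choice (len Q) (set (conf G2)) (fun v H =>
   [/\ seg H (D (B v) (pos v)) (f (gstep (pos v))), exists h, H h &
    forall h, H h -> forall k p, tp h k p = tp (f (pos v)) k p \/
       tp h k p = tp (f (gstep (pos v))) k p]).
  have [K1 s1 K1P] := DL (B v) _ (Bd v) (Qs v).
  have [K2 [s2 [k K2k] K2P]] := sim_step (Qh v).
  exists (K1 `|` K2); split; first exact: seg_trans s1 s2.
    by exists k; right.
  by move=> h [/K1P -> k' p|/K2P]; [left|].
have tpD P e k p : tp (D P e) k p = tp (f e) k p by rewrite /D; case: pselect.
have main (P : len Q -> Prop) e : (forall a b, P b -> ord a b -> P a) -> plands Q P c e ->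
    lands (@ord _ Q) (fun v => f (gstep (pos v))) H' P (f c) (D P e).
  move=> Pd [le lm ll]; split.
  - by move=> /[dup] Pe /le ->; rewrite /D; case: pselect => /= [[[a Pa] ub]|//]; case: (Pe a).
  - move=> m Pm mmax; rewrite (lm m) // /D; case: pselect => /= [[ne0 ub]|//].
    by have [b /mmax ->] := ub m Pm.
  move=> ne unb; have [se he tpe] := ll ne unb.
  rewrite /D; case: pselect => [lm0|[]//]; split=> //= k p.
  have mem g : P g -> exists2 h, H' g h & tp h k p = tp (f (pos g)) k p.
    move=> Pg; have [sg ng _] := H'P g.
    by exists (D (B g) (pos g)); [apply: seg_first sg ng|rewrite tpD].
  have [[k1 [p1 E]]|[b E]] := f_tape k p; last first.
    rewrite E; split=> [bt b1 Pb1|].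
      have [h Hh hk] := mem _ Pb1; exists b1; split=> //; first exact: (wo_refl wo).
      by exists h => //; rewrite hk E.
    case: ne => x Px /(_ x Px) [g [Pg _ [h Hh hk]]].
    by have [_ _ /(_ h Hh k p)] := H'P g; rewrite !E hk => -[].
  rewrite E tpe; split=> lim x Px.
    have [g [Pg xg [h -> hk]]] := lim x Px; exists g; split=> //.
    by have [h' Hh' hk'] := mem _ Pg; exists h' => //; rewrite hk' E.
  have [g [Pg xg [h Hh hk]]] := lim x Px.
  have [_ _ /(_ h Hh k p)] := H'P g; rewrite !E hk => -[hg|hg].
    by exists g; split=> //; exists (pos g).
  (* Here the bit is only known as a new value in the block of [g]. It is the old value at the next
     stage [y], which lies in [P] because [P] has no last stage. *)
  have [b1 Pb1 gb1] := unb g Pg.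
  have [|y yg ymin] := wo_min wo (P := fun y => ~~ ord y g); first by exists b1.
  have Py : P y by apply: Pd Pb1 _; apply: ymin.
  exists y; split=> //.
    by apply: (wo_trans wo) xg _; apply: (wo_ltW wo).
  exists (pos y) => //; suff -> : pos y = gstep (pos g) by rewrite -hg.
  have [_ + _] := Qs y; apply=> // a ay.
  by apply: contraT => /ymin ya; rewrite /before ya in ay.
have [K sK _] := DL (fun=> True) d (fun _ _ _ _ => I) Qe.
exists ((fun h => exists v, H' v h) `|` K); apply: seg_trans sK.
apply: (seg_sum (R := @ord _ Q) (d := fun v => D (B v) (pos v))
  (e := fun v => f (gstep (pos v)))) => //.
- by move=> v; have [] := H'P v.
- by move=> v; have [] := H'P v.
- by move=> v; apply: main => //; apply: Bd.
- exact: main.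
Qed.

End Simulation.

Definition load (T : finType) (k0 : T) (x : real) : T -> real :=
  fun k => if k == k0 then x else zeros.

Definition gcomputes (G : gm) (i o : trk G) (x y : real) : Prop :=
  exists H c, [/\ seg H (Conf (gstart G) 0 (load i x)) c,
                  st c = ghalt G & tp c o = y].

(** * Three-tape machines as machines with three tracks *)

Definition tape : finType := option bool.
Notation TI := (None : tape).
Notation TS := (Some false : tape).
Notation TO := (Some true : tape).

Definition tri (T : Type) (u v w : T) (k : tape) : T :=
  match k with None => u | Some false => v | Some true => w end.

Definition gm_of (M : ittm) : gm :=
  @GM tape (state M) (start M) (limit M) (halt M) (fun q s =>
    let: (q', (u, v, w), d) := delta q (s TI, s TS, s TO) in (q', tri u v w, d)).

Section Bridge.
Variable M : ittm.
Let G := gm_of M.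

Definition conv (c : config M) : conf G :=
  @Conf G (cstate c) (head c) (tri (tin c) (tscr c) (tout c)).

Definition unconv (c : conf G) : config M :=
  @Config M (st c) (hd c) (tp c TI) (tp c TS) (tp c TO).

Lemma convK c : unconv (conv c) = c. Proof. by case: c. Qed.

Lemma unconvK c : conv (unconv c) = c.
Proof.
by case: c => q n t; rewrite /conv /=; congr Conf; apply/funext => -[[]|].
Qed.

Lemma conv_step c : ~~ halted c -> conv (step c) = gstep (conv c).
Proof.
rewrite /step => /negbTE ->; rewrite /gstep /=.
case: (delta _ _) => -[q [[u v] w]] e; rewrite /conv /=; congr Conf.
by apply/funext => -[[]|]; apply/funext => p /=; case: eqP.
Qed.

Lemma conv_initial x : conv (initial M x) = Conf (gstart G) 0 (load TI x).
Proof. by congr Conf; apply/funext => -[[]|]. Qed.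

(** The stages strictly before the first halting one form the course. *)
Lemma outputs_gcomputes x y : outputs M x y -> gcomputes (G := G) TI TO x y.
Proof.
move=> [W [R [c [a [wo [rfirst rsucc rlim] ha hb <-]]]]].
pose S := {b | before R b a}.
pose Q := @Course G S (fun u v => R (sval u) (sval v)) (fun u => conv (c (sval u))).
have hold b : R b a -> plands Q (fun x : S => before R (sval x) b) (conv (initial M x)) (conv (c b)).
  move=> ba; have up g : before R g b -> before R g a.
    by move=> gb; apply: (wo_lt_le wo) gb ba.
  split.
  - move=> emp; rewrite rfirst // => g; apply: contraT => gb.
    by case: (emp (exist _ g (up g gb))).
  - move=> [m ma] mb mmax; rewrite -conv_step ?hb //; congr conv.
    by apply: rsucc; split=> // g gb; apply: (mmax (exist _ g (up g gb))).
  - move=> [[u ua] ub] unb; have [|sb hb0 lim] := rlim b.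
      split; first by exists u.
      move=> g gb; have [[h ha'] hb' gh] := unb (exist _ g (up g gb)) gb.
      by exists h.
    split=> // k p.
    have := lim p => -[l1 l2 l3].
    have {lim l1 l2 l3}: is_limsup R (fun g => tp (conv (c g)) k p) b (tp (conv (c b)) k p).
      by case: k => [[]|].
    rewrite /is_limsup => ->; split=> [l [g ga] gb|l g gb].
      have [h gh [hb1 hk]] := l g gb.
      by exists (exist _ h (up h hb1)); split=> //; exists (conv (c h)).
    have [[h hha] [hb1 gh [e -> ek]]] := l (exist _ g (up g gb)) gb.
    by exists h.
exists (fun h => exists u : len Q, pos u = h), (conv (c a)).
split=> //; last exact/eqP.
rewrite -conv_initial; exists Q => //; split.
- apply: well_order_intro => [[u ua] [v va] uv vu|P [[u0 ua] Pu]].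
    have E := wo_anti wo uv vu; rewrite /= in E; subst v.
    by congr exist; apply: Prop_irrelevance.
  have [|z [za Pz] zmin] := wo_min wo (P := fun z => exists za, P (exist _ z za)).
    by exists u0, ua.
  by exists (exist _ z za) => // -[v va] Pv; apply: zmin; exists va.
- by move=> [u ua]; apply: hold; apply: (wo_ltW wo).
- apply: lands_ext (hold a (wo_refl wo a)) => -[u ua].
  by split.
- by move=> [u ua] /=; apply: hb.
Qed.

(** A segment does not contain its end, so a top stage [None] is added to carry the halting
    configuration. *)
Lemma gcomputes_outputs x y : gcomputes (G := G) TI TO x y -> outputs M x y.
Proof.
move=> [H [d [[Q [wo Qs Qe Qh] _] sd <-]]].
pose R (u v : option (len Q)) : bool :=
  match u, v with Some u, Some v => ord u v | None, Some _ => false | _, None => true end.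
pose c (u : option (len Q)) := unconv (if u is Some u then pos u else d).
have hold o : plands Q (fun x => before R (Some x) o) (conv (initial M x)) (conv (c o)).
  by rewrite conv_initial /c; case: o => [u|]; rewrite unconvK; [exact: Qs|apply: lands_ext Qe].
exists (option (len Q)), R, c, None; split=> //.
- apply: well_order_intro => [[u|] [v|] //= uv vu|P [u Pu]].
    by rewrite (wo_anti wo uv vu).
  have [[v Pv]|no] := pselect (exists v, P (Some v)).
    have [|z Pz zmin] := wo_min wo (P := fun v => P (Some v)); first by exists v.
    by exists (Some z) => // -[w|] //= /zmin.
  exists u => // -[v|]; last by case: (u).
  by move=> Pv; case: no; exists v.
- split.
  + move=> o ofirst; have [+ _ _] := hold o.
    move=> E; rewrite -(convK (c o)) E ?convK // => a; rewrite /before.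
    by rewrite (ofirst (Some a)).
  + move=> o b [bo bmax]; case: b bo bmax => [b|]; last by case: o.
    move=> bo bmax; have [_ + _] := hold o => /(_ b bo) E.
    rewrite -(convK (c o)) E; last by move=> a ao; apply: (bmax (Some a)).
    rewrite -[RHS]convK conv_step /c ?unconvK //.
    exact: Qh.
  + move=> o [[b bo] unb]; have [_ _ lim] := hold o.
    have sm g : before R g o -> exists g', g = Some g'.
      by case: g => [g _|]; [exists g|case: o {bo unb lim}].
    case: lim => [||sl hl tl].
    * by have [b' E] := sm _ bo; subst b; exists b'.
    * move=> a ao; have [g ag go] := unb (Some a) ao.
      by have [g' E] := sm _ go; subst g; exists g'.
    * have lk k n : is_limsup R (fun g => tp (conv (c g)) k n) o (tp (conv (c o)) k n).
        rewrite /is_limsup tl; split=> l g go.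
          have [g' E] := sm _ go; subst g.
          have [h [ho gh [e -> ek]]] := l g' go.
          by exists (Some h) => //; split=> //; rewrite /c unconvK.
        have [h gh [ho hk]] := l (Some g) go.
        have [h' E] := sm _ ho; subst h; exists h'; split=> //.
        by exists (pos h') => //; move: hk; rewrite /c unconvK.
      by split=> // n; split; [apply: (lk TI)|apply: (lk TS)|apply: (lk TO)].
- exact/eqP.
- by move=> [b|] //= _; apply: Qh.
Qed.

End Bridge.

Lemma gstepE (G : gm) q h (t : trk G -> real) q' w d t' :
  gdelta q (fun k => t k h) = (q', w, d) ->
  (forall k p, t' k p = if p == h then w k else t k p) ->
  gstep (Conf q h t) = Conf q' (move d h) t'.
Proof.
rewrite /gstep /= => -> tE; congr Conf.
by apply/funext => k; apply/funext => p; rewrite tE.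
Qed.

Lemma gstep_same (G : gm) q h (t : trk G -> real) q' d :
  gdelta q (fun k => t k h) = (q', fun k => t k h, d) ->
  gstep (Conf q h t) = Conf q' (move d h) t.
Proof. by move=> /gstepE; apply=> k p; case: eqP => // ->. Qed.

Lemma walk_left (G : gm) (I : set (conf G)) q (t : trk G -> real) h h' :
  h <= h' -> q != ghalt G ->
  (forall p, h < p <= h' -> gdelta q (fun k => t k p) = (q, fun k => t k p, Left)) ->
  (forall p, I (Conf q p t)) ->
  walk I (Conf q h' t) (Conf q h t).
Proof.
move=> /subnKC <- qh; elim: (h' - h) => [|m IH] dq It.
  by rewrite addn0; apply: walk0.
apply: walkS => //; rewrite (gstep_same (dq _ _)); last by lia.
by rewrite addnS /=; apply: IH => // p hp; apply: dq; lia.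
Qed.

Lemma walk_right (G : gm) (I : set (conf G)) q (t : trk G -> real) h h' :
  h <= h' -> q != ghalt G ->
  (forall p, h <= p < h' -> gdelta q (fun k => t k p) = (q, fun k => t k p, Right)) ->
  (forall p, I (Conf q p t)) ->
  walk I (Conf q h t) (Conf q h' t).
Proof.
move=> /subnKC <- qh; move: (h' - h) => m; elim: m h => [|m IH] h dq It.
  by rewrite addn0; apply: walk0.
apply: walkS => //; rewrite (gstep_same (dq _ _)); last by lia.
by rewrite addnS -addSn /=; apply: IH => // p hp; apply: dq; lia.
Qed.

Lemma walk_iter (G : gm) (I : set (conf G)) (c : nat -> conf G) m n :
  m <= n ->
  (forall j, m <= j < n -> [/\ I (c j), st (c j) != ghalt G & gstep (c j) = c j.+1]) ->
  walk I (c m) (c n).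
Proof.
move=> /subnKC <-; move: (n - m) => l; elim: l m => [|l IH] m cs.
  by rewrite addn0; apply: walk0.
have [|Im hm em] := cs m; first by lia.
apply: walkS => //; rewrite em addnS -addSn.
by apply: IH => j hj; apply: cs; lia.
Qed.

(** * Compilation to three tapes *)

(** A configuration of a machine with tracks [T] is stored on the output tape,
    in blocks of length [K = bsize T]: bit [n] of track [k] sits in cell
    [K * n + idx k].  The input is first stretched ([ph = false]) to the blocks,
    and the output finally compressed ([ph = true]) back to consecutive cells,
    in [omega] steps each.  Both carry bits between two markers [A] and [B] on
    the scratch tape, the first advancing by one cell and the second by [K]
    cells.  At a limit stage, the bits of cell 0 of the scratch and input tapes
    tell which phase is in progress. *)
Inductive block_state (Q : finType) (N : nat) :=
  | CLim
  | CHalt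
  | CIni (ph b : bool) (j : 'I_N.+1)
  | CSeekA (ph b : bool)
  | CSetA (ph b : bool)
  | CSeekB (ph b : bool)
  | CMoveB (ph b : bool) (j : 'I_N.+1)
  | CRead (q : Q) (j : 'I_N.+1) (w : {ffun 'I_N.+1 -> bool})
  | CWrite (q : Q) (j : 'I_N.+1) (w : {ffun 'I_N.+1 -> bool}) (d : bool)
  | CMove (q : Q) (j : 'I_N.+1) (d : bool).

Arguments CLim {Q N}.
Arguments CHalt {Q N}.
Arguments CIni {Q N}.
Arguments CSeekA {Q N}.
Arguments CSetA {Q N}.
Arguments CSeekB {Q N}.
Arguments CMoveB {Q N}.
Arguments CRead {Q N}.
Arguments CWrite {Q N}.
Arguments CMove {Q N}.

Section BlockStateFinite.
Variables (Q : finType) (N : nat).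
Let J := 'I_N.+1.
Let S : Type := (bool + bool * bool * J + bool * bool * 'I_3 + bool * bool * J +
  Q * J * {ffun J -> bool} + Q * J * {ffun J -> bool} * bool + Q * J * bool)%type.

Definition block_state_enc (s : block_state Q N) : S :=
  match s with
  | CLim => inl (inl (inl (inl (inl (inl false)))))
  | CHalt => inl (inl (inl (inl (inl (inl true)))))
  | CIni ph b j => inl (inl (inl (inl (inl (inr (ph, b, j))))))
  | CSeekA ph b => inl (inl (inl (inl (inr (ph, b, inord 0)))))
  | CSetA ph b => inl (inl (inl (inl (inr (ph, b, inord 1)))))
  | CSeekB ph b => inl (inl (inl (inl (inr (ph, b, inord 2)))))
  | CMoveB ph b j => inl (inl (inl (inr (ph, b, j))))
  | CRead q j w => inl (inl (inr (q, j, w)))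
  | CWrite q j w d => inl (inr (q, j, w, d))
  | CMove q j d => inr (q, j, d)
  end.

Definition block_state_dec (s : S) : block_state Q N :=
  match s with
  | inl (inl (inl (inl (inl (inl b))))) => if b then CHalt else CLim
  | inl (inl (inl (inl (inl (inr (ph, b, j)))))) => CIni ph b j
  | inl (inl (inl (inl (inr (ph, b, i))))) =>
      if i == 0 :> nat then CSeekA ph b else if i == 1 :> nat then CSetA ph b
      else CSeekB ph b
  | inl (inl (inl (inr (ph, b, j)))) => CMoveB ph b j
  | inl (inl (inr (q, j, w))) => CRead q j w
  | inl (inr (q, j, w, d)) => CWrite q j w d
  | inr (q, j, d) => CMove q j d
  end.

Lemma block_state_encK : cancel block_state_enc block_state_dec.
Proof. by case=> //= *; rewrite inordK. Qed.

End BlockStateFinite.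

HB.instance Definition _ (Q : finType) N :=
  Finite.copy (block_state Q N) (can_type (@block_state_encK Q N)).

(** Length of a block: its first two cells hold the output and input tracks. *)
Definition bsize (T : finType) : nat := locked #|T|.+2.

Lemma bsize_gt1 (T : finType) : 1 < bsize T. Proof. by rewrite /bsize -lock. Qed.

Section Compile.
Variables (G : gm) (i o : trk G).
Hypothesis io : i != o.

Local Notation K := (bsize (trk G)).
(** Bound for the counters in states: the compression puts its second marker into cell [2 * K]. *)
Local Notation N := (K + K).
Local Notation cst := (block_state (gst G) N).
Local Notation buf := {ffun 'I_N.+1 -> bool}.

Definition idx (k : trk G) : nat :=
  if k == o then 0 else if k == i then 1 else (enum_rank k).+2.

Lemma idx_lt k : idx k < K.
Proof. by rewrite /idx /bsize -lock; case: ifP => // _; case: ifP => // _; rewrite !ltnS. Qed.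

Lemma idx_inj : injective idx.
Proof.
move=> k l; rewrite /idx.
case: eqP => [->|_]; first by case: eqP => // _; case: ifP.
case: eqP => [->|_]; first by case: ifP => // _; case: eqP.
by case: ifP => // _; case: ifP => // _ [] /ord_inj/enum_rank_inj.
Qed.

Definition sym (w : buf) (k : trk G) : bool := w (inord (idx k)).

Definition unsym (w : trk G -> bool) : buf :=
  [ffun j : 'I_N.+1 => [exists k, (idx k == j) && w k]].

Definition dirb (d : bool) := if d then Right else Left.

Definition cmove (q : gst G) (j : nat) (d : bool) : cst :=
  if j == 0 then CRead q ord0 [ffun=> false] else CMove q (inord j) d.

(** Bit 0 needs no transport: the stretch copies it at once into cell 1, and for the compression it
    is in place. In the compression the bit in hand is one ahead of the marker [B]: the bit of cell
    [K] is picked up here, and the markers start in cells 1 and [2 * K]. *)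
Definition cini (ph b : bool) (j : nat) (s : tape -> bool) : cst * (tape -> bool) * direction :=
  let b' := if ph then if j == K then s TO else b else if j == 0 then s TI else b in
  let s' :=
    if ph then tri (s TI) [|| j == 0, j == 1 | j == K + K] (s TO)
    else tri (if j == 0 then false else s TI) ((j == 1) || (j == K.+1))
             (if j == 1 then b' else s TO) in
  if j < (if ph then K + K else K.+1) then (CIni ph b' (inord j.+1), s', Right)
  else (CSeekA ph b', s', Left).

(** In [CLim], a scratch mark in cell 0 means that the compression is over, an input mark that [G]
    itself is at a limit stage, no mark that the stretch is over. The input mark also stops the walk
    back to cell 0 once [G] has halted. *)
Definition cdelta (q : cst) (s : tape -> bool) : cst * (tape -> bool) * direction :=
  match q with
  | CLim =>
      if s TS then (CHalt, s, Left)
      else if s TI then (cmove (glim G) 0 false, s, Left)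
      else (cmove (gstart G) 0 false, tri true (s TS) (s TO), Left)
  | CHalt => (CHalt, s, Left)
  | CIni ph b j => cini ph b j s
  | CSeekA ph b =>
      if s TS then
        (CSetA ph (if ph then b else s TI),
         tri (if ph then s TI else false) false (if ph then b else s TO), Right)
      else (q, s, Left)
  | CSetA ph b => (CSeekB ph b, tri (s TI) true (s TO), Right)
  | CSeekB ph b =>
      if s TS then
        (CMoveB ph (if ph then s TO else b) (inord K.-1),
         tri (s TI) false (if ph then s TO else b), Right)
      else (q, s, Right)
  | CMoveB ph b j =>
      if j == 0 :> nat then (CSeekA ph b, tri (s TI) true (s TO), Left)
      else (CMoveB ph b (inord j.-1), s, Right)
  | CRead q' j w =>
      if q' == ghalt G then if s TI then cini true false 0 s else (q, s, Left)
      else if j < K then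
        (CRead q' (inord j.+1) [ffun l : 'I_N.+1 => if l == j then s TO else w l], s, Right)
      else let: (q1, w1, d) := gdelta q' (sym w) in
        (CWrite q1 (inord K.-1) (unsym w1) (if d is Right then true else false), s, Left)
  | CWrite q' j w d =>
      (if j == 0 :> nat then cmove q' K.-1 d else CWrite q' (inord j.-1) w d,
       tri (s TI) (s TS) (w j), if j == 0 :> nat then dirb d else Left)
  | CMove q' j d => (cmove q' j.-1 d, s, dirb d)
  end.

Definition craw : gm := @GM tape cst (CIni false false ord0) CLim CHalt cdelta.

Definition cittm : ittm.
Proof.
refine (@Ittm cst (CIni false false ord0) CLim CHalt _ (fun q s =>
  let: (u, v, w) := s in
  let: (q', s', d) := cdelta q (tri u v w) in
  (q', (s' TI, s' TS, s' TO), d))).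
by [].
Defined.

Lemma craw_outputs x y : gcomputes (G := craw) TI TO x y -> outputs cittm x y.
Proof.
move=> cxy; apply: gcomputes_outputs.
(* The two transition functions agree only extensionally, so the machine is abstracted over its
   transition function. *)
pose machine d := @GM tape cst (CIni false false ord0) CLim CHalt d.
suff {cxy} E : @gdelta (gm_of cittm) = cdelta.
  by change (gcomputes (G := machine (@gdelta (gm_of cittm))) TI TO x y); rewrite E.
apply/funext => q; apply/funext => s /=.
have -> : tri (s TI) (s TS) (s TO) = s by apply/funext => -[[]|].
case: (cdelta q s) => -[q' s'] d; congr (_, _, _).
by apply/funext => -[[]|].
Qed.

Definition marks (ph : bool) (a b p : nat) : bool :=
  [|| ph && (p == 0), p == a | p == b].

Lemma inordN j : j <= N -> (inord j : 'I_N.+1) = j :> nat.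
Proof. by move=> jN; rewrite inordK. Qed.

Lemma marksF ph a b p : 0 < p -> p != a -> p != b -> marks ph a b p = false.
Proof. by rewrite /marks; case: p => // p _ /negbTE -> /negbTE ->; rewrite andbF. Qed.

(** One round trip between the markers. Nothing to the left of [A] changes on the way, so every cell
    is final after finitely many rounds. *)
Lemma loop ph b a c (ti to : real) : 0 < a -> a.+1 < c ->
  let t := tri ti (marks ph a c) to in
  let t' := tri (fun p => if ~~ ph && (p == a) then false else ti p)
    (marks ph a.+1 (c + K))
    (fun p => if ph && (p == a) then b else if ~~ ph && (p == c) then ti a else to p) in
  exists H, [/\ seg H (@Conf craw (CSeekA ph b) a t)
      (@Conf craw (CSeekA ph (if ph then to c else ti a)) a.+1 t'),
    exists h, H h & forall h, H h -> forall k p, p < a -> tp h k p = t k p].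
Proof.
move=> a0 ac; have K2 := @bsize_gt1 (trk G).
have E1 : (a == 0) = false by lia.
have E2 : (a == c) = false by lia.
have E3 : (c == a) = false by lia.
move=> t t'; pose I := [set h : conf craw | forall k p, p < a -> tp h k p = t k p].
pose ti' : real := fun p => if ~~ ph && (p == a) then false else ti p.
pose to' : real := fun p => if ph && (p == a) then b else to p.
pose to'' : real := fun p => if ph && (p == a) then b else if ~~ ph && (p == c) then ti a else to p.
pose b1 := if ph then b else ti a.
pose b2 := if ph then to c else ti a.
have It' q h m : (forall p, p < a -> m p = (ph && (p == 0))) -> I (@Conf craw q h (tri ti' m to')).
  move=> mE [[]|] p pa /=; rewrite /to' /ti' ?mE //= ?(ltn_eqF pa) ?andbF //.
  by rewrite /marks (ltn_eqF pa); lia.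
have It'' q h m : (forall p, p < a -> m p = (ph && (p == 0))) -> I (@Conf craw q h (tri ti' m to'')).
  move=> mE [[]|] p pa /=; rewrite /to'' /ti' ?mE //= ?(ltn_eqF pa) ?andbF //.
    by rewrite (_ : (p == c) = false) ?andbF //; lia.
  by rewrite /marks (ltn_eqF pa); lia.
apply: (walk_seg1 (I := I)) => //.
rewrite (@gstepE craw _ _ _ (CSetA ph b1) (tri (if ph then ti a else false) false (if ph then b else to a)) Right
  (tri ti' (fun p => ph && (p == 0) || (p == c)) to')); first last.
- by move=> [[]|] p /=; rewrite /to' /ti' /marks; case: (eqVneq p a) => [->|pa] /=; rewrite ?andbF ?andbT //; [rewrite E1 E2 andbF|case: (ph)].
- by rewrite /= /marks eqxx orbT.
apply: walkS => //; first by apply: It'; lia.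
rewrite (@gstepE craw _ _ _ (CSeekB ph b1) (tri (ti' a.+1) true (to' a.+1)) Right
  (tri ti' (marks ph a.+1 c) to')) //; last first.
  by move=> [[]|] p /=; rewrite /marks; case: (eqVneq p a.+1) => [->|_] /=; rewrite ?orbT.
have -> : move Right (move Right a) = a.+2 by [].
apply: walk_trans.
  apply: (@walk_right craw _ _ _ _ c) => //.
    by move=> p hp /=; rewrite marksF //; clear -hp; lia.
  by move=> p; apply: It'; rewrite /marks; lia.
apply: walkS => //; first by apply: It'; rewrite /marks; lia.
rewrite (@gstepE craw _ _ _ (CMoveB ph b2 (inord K.-1)) (tri (ti' c) false (to'' c)) Right
  (tri ti' (fun p => ph && (p == 0) || (p == a.+1)) to'')); first last.
- move=> [[]|] p /=; rewrite /to' /to'' /marks; case: (eqVneq p c) => [->|] //=; try lia.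
    by rewrite eqxx.
  by rewrite ?andbF.
- rewrite /= /marks eqxx !orbT /b1 /b2 /to' /to'' eqxx (_ : c == a = false); last by lia.
  by case: (ph).
have mv m : m <= K.-1 ->
    walk I (@Conf craw (CMoveB ph b2 (inord m)) (c + K - m) (tri ti' (fun p => ph && (p == 0) || (p == a.+1)) to''))
      (@Conf craw (CMoveB ph b2 (inord 0)) (c + K) (tri ti' (fun p => ph && (p == 0) || (p == a.+1)) to'')).
  elim: m => [|m IH] mK; first by rewrite subn0; apply: walk0.
  apply: walkS => //; first by apply: It''; lia.
  rewrite (@gstep_same craw _ _ _ (CMoveB ph b2 (inord m)) Right).
    by rewrite (_ : move Right (c + K - m.+1) = c + K - m) /=; [apply: IH|]; lia.
  by rewrite /= inordN //; lia.
have -> : move Right c = c + K - K.-1.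
  by rewrite /=; lia.
apply: (walk_trans (mv _ (leqnn _))).
apply: walkS => //; first by apply: It''; lia.
rewrite (@gstepE craw _ _ _ (CSeekA ph b2) (tri (ti' (c + K)) true (to'' (c + K))) Left t'); first last.
- by move=> [[]|] p /=; rewrite /marks; case: (eqVneq p (c + K)) => [->|] //=; rewrite ?orbT ?orbF.
- by rewrite /= inordN.
apply: walk_left => //; first by rewrite /=; lia.
  by move=> p /= hp; rewrite marksF //; clear -hp; lia.
by move=> p; apply: It''; rewrite /marks; lia.
Qed.

Lemma divK m j : j < K -> (K * m + j) %/ K = m.
Proof. by move=> jK; rewrite mulnC divnMDl ?divn_small ?addn0 //; lia. Qed.

Lemma modK m j : j < K -> (K * m + j) %% K = j.
Proof. by move=> jK; rewrite mulnC modnMDl modn_small. Qed.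

Lemma eq_cell p m j : j < K -> (p == K * m + j) = (p %% K == j) && (p %/ K == m).
Proof.
move=> jK; apply/eqP/andP => [->|[/eqP <- /eqP <-]]; first by rewrite divK ?modK.
by rewrite mulnC -divn_eq.
Qed.

Lemma stretch_ini x : exists b H,
  seg H (@Conf craw (CIni false false ord0) 0 (load TI x))
    (@Conf craw (CSeekA false b) 1 (tri (fun p => (0 < p) && x p)
       (marks false 1 (K * 1 + 1)) (fun p => [&& p %% K == 1, p %/ K <= 0 & x (p %/ K)]))).
Proof.
have K2 := @bsize_gt1 (trk G).
pose c j := @Conf craw (CIni false (if j == 0 then false else x 0) (inord j)) j
  (tri (fun p => if j == 0 then x p else (0 < p) && x p) (fun p => (p < j) && (p == 1))
     (fun p => [&& p < j, p == 1 & x 0])).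
have c0 : @Conf craw (CIni false false ord0) 0 (load TI x) = c 0.
  rewrite /c; congr Conf; first by congr CIni; apply/val_inj; rewrite /= inordN.
  by apply/funext => -[[]|]; apply/funext => p.
suff w : walk setT (c 0) (@Conf craw (CSeekA false (x 0)) 1 (tri (fun p => (0 < p) && x p)
       (marks false 1 (K * 1 + 1)) (fun p => [&& p %% K == 1, p %/ K <= 0 & x (p %/ K)]))).
  by have [H sH _] := walk_seg w; exists (x 0), H; rewrite c0.
apply: (walk_trans (walk_iter (leq0n K.+1) _)).
  move=> j /= jK; split=> //.
  rewrite (@gstepE craw _ _ _ (CIni false (x 0) (inord j.+1)) (fun k => tp (c j.+1) k j) Right
    (tp (c j.+1))) //.
    rewrite /= /cini inordN; last by lia.
    rewrite ltnS -ltnS jK; congr (CIni _ _ _, _, _); first by case: (j).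
    apply/funext => -[[]|] /=.
    - case: (j) => [|[|j']] /=; rewrite ?andbF //.
    - by rewrite ltnSn /=; lia.
    - by case: (j).
  move=> [[]|] p /=; case: (eqVneq p j) => [->|pj] //=; try (by rewrite ltnS leq_eqVlt (negbTE pj)).
  by case: (j) pj => // ; case: p.
apply: walkS => //.
rewrite (@gstepE craw _ _ _ (CSeekA false (x 0)) (tri (x K.+1) true false) Left
  (tri (fun p => (0 < p) && x p)
       (marks false 1 (K * 1 + 1)) (fun p => [&& p %% K == 1, p %/ K <= 0 & x (p %/ K)]))).
- apply: walk_left => //; first by rewrite /=; lia.
  move=> p /= hp; rewrite muln1 marksF //; clear -hp; lia.
- rewrite /= /cini inordN; last by lia.
  by rewrite eqxx orbT ltnn /= (_ : K.+1 == 1 = false) ?andbF //; lia.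
- move=> [[]|] p /=.
  + rewrite leqn0 andbA -eq_cell // muln0 add0n; case: (eqVneq p 1) => [->|p1] /=.
      by rewrite divn_small // ltnS (ltnW K2) ifF //; lia.
    by rewrite andbF if_same.
  + by rewrite /marks muln1 addn1 /=; case: (eqVneq p K.+1) => [->|pj] /=; lia.
  + by case: eqP => [->|].
Qed.

(** The markers run off to infinity and the input is erased bit by bit, so both of these tapes are
    blank at the limit: the pattern that [CLim] takes for the end of the stretch. *)
Lemma stretch x : exists H t,
  [/\ seg H (@Conf craw (CIni false false ord0) 0 (load TI x)) (@Conf craw CLim 0 t),
    forall p, t TI p = false, forall p, t TS p = false &
    forall p, t TO p = (p %% K == 1) && x (p %/ K)].
Proof.
have K2 := @bsize_gt1 (trk G).
pose T n : tape -> real := tri (fun p => (n < p) && x p) (marks false n.+1 (K * n.+1 + 1))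
   (fun p => [&& p %% K == 1, p %/ K <= n & x (p %/ K)]).
pose Inv n (c : conf craw) := exists b, c = @Conf craw (CSeekA false b) n.+1 (T n).
pose Good n (H : set (conf craw)) := (exists h, H h) /\
  forall h, H h -> forall k p, p <= n -> tp h k p = T n k p.
have [b [H0 s0]] := stretch_ini x.
have [||H [t [HG sH tE]]] := @seg_omega craw Inv Good (@Conf craw (CSeekA false b) 1 (T 0)).
- by exists b.
- move=> n c [b' ->].
  have [|H [sH ne HP]] := @loop false b' n.+1 (K * n.+1 + 1) (T n TI) (T n TO) (ltn0Sn n).
    have : 2 * n.+1 <= K * n.+1 by rewrite leq_pmul2r.
    by clear; lia.
  move: sH.
  set t1 := tri _ _ _; set t2 := tri _ _ _; rewrite (_ : t2 = T n.+1); last first.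
    rewrite /t2 /T; congr tri; apply/funext => p /=.
    - by case: (eqVneq p n.+1) => [->|pn]; [rewrite ltnn|congr (_ && _); lia].
    - by congr (marks _ _ _ p); rewrite [in RHS]mulnS; lia.
    - rewrite eq_cell //; case: (eqVneq (p %% K) 1) => //= _.
      case: (eqVneq (p %/ K) n.+1) => [->|pn]; first by rewrite /= leqnn.
      by congr (_ && _); lia.
  move=> sH; exists H, (@Conf craw (CSeekA false (x n.+1)) n.+2 (T n.+1)); split=> //.
  - by move: sH; rewrite /= ltnSn.
  - by exists (x n.+1).
exists (H0 `|` (fun h => exists n, H n h)), t.
have ne n : exists h, H n h by have [] := HG n.
have ev k p v : (forall n, p <= n -> T n k p = v) -> t k p = v.
  move=> Tv; apply: (limsup_eventually (N := p) (tE k p) ne) => n h pn Hh.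
  by have [_ HP] := HG n; rewrite (HP h Hh k p pn) Tv.
split; first exact: seg_trans s0 sH.
- by move=> p; apply: ev => n pn; rewrite /T /= ltnNge pn.
- move=> p; apply: ev => n pn; rewrite /T /= /marks /=.
  by have := @leq_pmull n.+1 K (ltnW K2); lia.
- by move=> p; apply: ev => n pn; rewrite /T /= (leq_trans (leq_div p K) pn).
Qed.

Lemma iter_move d n p :
  iter n (move d) p = if d is Right then p + n else p - n.
Proof. by case: d; elim: n => [|n IH]; rewrite ?subn0 ?addn0 //= IH; lia. Qed.

Definition emb_tape (t : trk G -> real) : tape -> real :=
  tri (fun p => p == 0) zeros
    (fun p => [exists k, (idx k == p %% K) && t k (p %/ K)]).

Definition emb (c : conf G) : conf craw :=
  @Conf craw (cmove (st c) 0 false) (K * hd c) (emb_tape (tp c)).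

Lemma emb_tapeE t k p : emb_tape t TO (K * p + idx k) = t k p.
Proof.
rewrite /emb_tape /= divK ?modK ?idx_lt //; apply/existsP/idP => [[l /andP[]]|tk].
  by move=> /eqP/idx_inj ->.
by exists k; rewrite eqxx.
Qed.

(** A block is read from left to right and rewritten from right to left, each cell passing directly
    from its old to its new value, as [simulation] demands. [K] moves follow, the first of them made
    by the last write. *)
Lemma emb_step c : st c != ghalt G ->
  exists H, [/\ seg H (emb c) (emb (gstep c)), exists h, H h &
    forall h, H h -> forall k p,
      tp h k p = tp (emb c) k p \/ tp h k p = tp (emb (gstep c)) k p].
Proof.
have K2 := @bsize_gt1 (trk G).
case: c => q h t qh; set c := Conf q h t.
pose I := [set h | forall k p, tp h k p = tp (emb c) k p \/ tp h k p = tp (emb (gstep c)) k p].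
case E : (gdelta q (fun k => t k h)) => [[q1 w1'] d].
pose t1 k p := if p == h then w1' k else t k p.
have cE : gstep c = Conf q1 (move d h) t1 by rewrite /gstep /= E.
pose T := emb_tape t; pose T1 := emb_tape t1.
pose db := if d is Right then true else false.
have dbE : dirb db = d by rewrite /db; case: (d).
pose rd j := @Conf craw (CRead q (inord j) [ffun l : 'I_N.+1 => (l < j) && T TO (K * h + l)])
  (K * h + j) T.
have rd0 : emb c = rd 0.
  rewrite /emb /rd /cmove /= addn0; congr Conf; congr CRead.
  by apply/val_inj; rewrite /= inordN.
have w1 : walk I (rd 0) (rd K).
  apply: walk_iter => // j /= jK; split=> //; first by left.
  rewrite (@gstep_same craw _ _ _ (CRead q (inord j.+1)
    [ffun l : 'I_N.+1 => (l < j.+1) && T TO (K * h + l)]) Right).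
    by rewrite /rd addnS.
  rewrite /= (negbTE qh) inordN; last by lia.
  rewrite jK; congr (CRead _ _ _, _, _); apply/ffunP => l; rewrite !ffunE.
  rewrite -val_eqE /= inordN; last by lia.
  by case: eqP => [->|lj]; [rewrite ltnSn|congr (_ && _); lia].
pose wr m := @Conf craw (CWrite q1 (inord (K.-1 - m)) (unsym w1') db) (K * h + (K.-1 - m))
  (tri (T TI) (T TS) (fun p => if K * h + (K.-1 - m) < p < K * h + K then T1 TO p else T TO p)).
have wr0 : gstep (rd K) = wr 0.
  rewrite (@gstep_same craw _ _ _ (CWrite q1 (inord K.-1) (unsym w1') db) Left).
    rewrite /wr subn0; congr Conf; first by rewrite /=; lia.
    apply/funext => -[[]|]; apply/funext => p //=.
    by rewrite ifF //; lia.
  rewrite /= (negbTE qh) inordN ?ltnn; last by lia.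
  set s := sym _; suff -> : s = fun k => t k h by rewrite E.
  apply/funext => k; rewrite /s /sym ffunE inordN; last by have := idx_lt k; lia.
  by rewrite idx_lt; exact: emb_tapeE.
have T1out p : p %/ K != h -> T1 TO p = T TO p.
  by move=> /negbTE ph; rewrite /T1 /T /= /t1 ph.
have T1in j : j < K -> T1 TO (K * h + j) = unsym w1' (inord j).
  move=> jK; rewrite /T1 /= /t1 ffunE divK // modK // eqxx.
  by apply: eq_existsb => k; rewrite inordN //; lia.
have Iwr j b l : I (@Conf craw b l (tri (T TI) (T TS) (fun p => if K * h + (K.-1 - j) < p < K * h + K then T1 TO p else T TO p))).
  by move=> [[]|] p; rewrite /= ?cE; try (by left); case: ifP => _; [right|left].
have w2 : walk I (wr 0) (wr K.-1).
  apply: walk_iter => // m /= mK; split=> //; first exact: Iwr.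
  set j := K.-1 - m; have j0 : 0 < j by rewrite /j; lia.
  have jE : K.-1 - m.+1 = j.-1 by rewrite /j; lia.
  have jK : j < K by rewrite /j; lia.
  rewrite /wr jE -/j.
  rewrite (@gstepE craw _ _ _ (CWrite q1 (inord j.-1) (unsym w1') db)
     (tri (T TI (K * h + j)) (T TS (K * h + j)) (T1 TO (K * h + j))) Left
     (tri (T TI) (T TS) (fun p => if K * h + j.-1 < p < K * h + K then T1 TO p else T TO p))).
  - by congr Conf; rewrite /=; lia.
  - rewrite -[@gdelta craw]/cdelta /cdelta inordN; last by lia.
    by rewrite (gtn_eqF j0) T1in.
  - move=> [[]|] p /=; case: (eqVneq p (K * h + j)) => [->|pj] //.
      by rewrite ifT //; lia.
    by congr (if _ then _ else _); lia.
pose mv m := @Conf craw (cmove q1 (K.-1 - m) db) (iter m.+1 (move (dirb db)) (K * h)) T1.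
have wrK : gstep (wr K.-1) = mv 0.
  rewrite /wr /mv subnn subn0 addn0 /=.
  rewrite (@gstepE craw _ _ _ (cmove q1 K.-1 db)
     (tri (T TI (K * h)) (T TS (K * h)) (T1 TO (K * h))) (dirb db) T1) //.
  - rewrite -[@gdelta craw]/cdelta /cdelta inordN //; rewrite eqxx.
    by have := T1in 0 (ltnW K2); rewrite addn0 => ->.
  - move=> [[]|] p; case: (eqVneq p (K * h)) => [->|pj] //.
    rewrite [RHS]/=; case: ifP => // pin; apply: T1out; apply: contraNneq pj => ph.
    by apply/eqP; move: pin; rewrite {1 2}(divn_eq p K) ph; have := ltn_pmod p (ltnW K2); lia.
have w3 : walk I (mv 0) (mv K.-1).
  apply: walk_iter => // m /= mK; split.
  - by right; rewrite cE.
  - by rewrite /mv /cmove; case: ifP.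
  rewrite /mv /cmove ifF; last by lia.
  rewrite (@gstep_same craw _ _ _ (cmove q1 (K.-1 - m.+1) db) (dirb db)) //.
  rewrite -[@gdelta craw]/cdelta /cdelta inordN; last by lia.
  by rewrite (_ : (K.-1 - m).-1 = K.-1 - m.+1) //; lia.
have mvK : mv K.-1 = emb (gstep c).
  rewrite cE /mv /emb subnn prednK; last by lia.
  (* A left move from block 0 stays in place on both sides, thanks to truncated subtraction. *)
  congr Conf; rewrite dbE iter_move; case: (d) => /=.
    by rewrite -subn1 mulnBr muln1.
  by rewrite mulnS addnC.
have [H1 s1 I1] := walk_seg w1; have [H2 s2 I2] := walk_seg w2.
have [H3 s3 I3] := walk_seg w3.
have s12 : seg [set rd K] (rd K) (wr 0) by rewrite -wr0; apply: seg_step.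
have s23 : seg [set wr K.-1] (wr K.-1) (mv 0) by rewrite -wrK; apply: seg_step.
exists (H1 `|` ([set rd K] `|` (H2 `|` ([set wr K.-1] `|` H3)))); split.
- rewrite rd0 -mvK; apply: seg_trans s1 _; apply: seg_trans s12 _.
  by apply: seg_trans s2 _; apply: seg_trans s23 s3.
- by exists (rd K); right; left.
- move=> e [/I1|[->|[/I2|[->|/I3]]]] //; first by left.
  exact: Iwr.
Qed.

Lemma emb_lim c : st c = glim G -> hd c = 0 ->
  exists2 H, seg H (@Conf craw CLim 0 (tp (emb c))) (emb c) &
    forall h, H h -> tp h = tp (emb c).
Proof.
case: c => q h t /= -> ->.
exists [set @Conf craw CLim 0 (emb_tape t)]; last by move=> _ ->.
suff <- : gstep (@Conf craw CLim 0 (emb_tape t)) = emb (Conf (glim G) 0 t) by apply: seg_step.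
by rewrite (@gstep_same craw _ _ _ (cmove (glim G) 0 false) Left) // /emb /= muln0.
Qed.

Lemma emb_simulation H c d : seg H c d -> exists H', seg H' (emb c) (emb d).
Proof.
apply: simulation; [|exact: emb_step|exact: emb_lim].
case=> [[]|] p.
- have [[k /eqP kp]|no] := pselect (exists k, idx k == p %% K).
    left; exists k, (p %/ K) => c'; rewrite -emb_tapeE kp.
    by rewrite {1}(divn_eq p K) mulnC.
  right; exists false => c' /=; apply/existsP => -[k /andP[kp _]].
  by apply: no; exists k.
- by right; exists false.
- by right; exists (p == 0).
Qed.

Lemma compress_ini q h (y u : real) : q = ghalt G -> (forall n, u (K * n) = y n) ->
  exists H, seg H (@Conf craw (cmove q 0 false) h (tri (fun p => p == 0) zeros u))
     (@Conf craw (CSeekA true (y 1)) 1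
       (tri (fun p => p == 0) (marks true 1 (K * 2)) (fun p => if p <= 0 then y p else u p))).
Proof.
move=> qh uy; have K2 := @bsize_gt1 (trk G).
pose c j := @Conf craw (CIni true (if j <= K then false else u K) (inord j)) j
  (tri (fun p => p == 0) (fun p => (p < j) && ((p == 0) || (p == 1))) u).
suff w : walk setT (@Conf craw (cmove q 0 false) h (tri (fun p => p == 0) zeros u))
    (@Conf craw (CSeekA true (y 1)) 1
       (tri (fun p => p == 0) (marks true 1 (K * 2)) (fun p => if p <= 0 then y p else u p))).
  by have [H sH _] := walk_seg w; exists H.
apply: (walk_trans (walk_left (h := 0) _ _ _ _)) => //.
  by move=> p p0 /=; rewrite qh eqxx ifF //; lia.
apply: walkS => //.
rewrite (@gstepE craw _ _ _ (CIni true false (inord 1)) (tri true true (u 0)) Right (tp (c 1))); first last.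
- by move=> [[]|] [|[|p]].
- by rewrite /= qh eqxx /cini eqxx /= addn_gt0 (ltnW K2) (ltn_eqF (ltnW K2)).
have -> : @Conf craw (CIni true false (inord 1)) (move Right 0) (tp (c 1)) = c 1.
  by rewrite /c (ltnW K2).
apply: (walk_trans (walk_iter (n := K + K) _ _)); first by lia.
  move=> j /= jK; split=> //.
  rewrite (@gstepE craw _ _ _ (CIni true (if j.+1 <= K then false else u K) (inord j.+1))
    (fun k => tp (c j.+1) k j) Right (tp (c j.+1))) //.
    rewrite /= /cini inordN; last by lia.
    rewrite (_ : j < K + K = true); last by lia.
    congr (CIni _ _ _, _, _).
      by case: (ltngtP j K) => [||->] //; lia.
    apply/funext => -[[]|] //=; rewrite ltnSn /=; lia.
  move=> [[]|] p /=; case: (eqVneq p j) => [->|pj] //=.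
  by rewrite ltnS leq_eqVlt (negbTE pj).
apply: walkS => //.
rewrite (@gstepE craw _ _ _ (CSeekA true (y 1)) (tri false true (u (K + K))) Left
  (tri (fun p => p == 0) (marks true 1 (K * 2)) (fun p => if p <= 0 then y p else u p))).
- apply: walk_left => //; first by rewrite /=; lia.
  by move=> p /= hp; rewrite marksF //; lia.
- rewrite /= /cini inordN // ltnn eqxx !orbT (_ : K + K <= K = false); last by lia.
  rewrite (_ : K + K == K = false); last by lia.
  rewrite -uy muln1; congr (_, tri _ _ _, _) => /=; lia.
- move=> [[]|] p /=.
  + case: (eqVneq p (K + K)) => [->|pj].
      by rewrite ifF //; lia.
    by case: p {pj} => //=; rewrite -uy muln0.
  + rewrite /marks (_ : K * 2 = K + K); last by lia.
    by case: (eqVneq p (K + K)) => [->|pj] /=; lia.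
  + by case: (eqVneq p (K + K)) => [->|pj] //; lia.
Qed.

(** The scratch mark in cell 0 is never removed, so it is still there at the limit and makes [CLim]
    halt. *)
Lemma compress q h (y u : real) : q = ghalt G -> (forall n, u (K * n) = y n) ->
  exists H t, [/\ seg H (@Conf craw (cmove q 0 false) h (tri (fun p => p == 0) zeros u))
     (@Conf craw CLim 0 t), t TO = y & t TS 0].
Proof.
move=> qh uy; have K2 := @bsize_gt1 (trk G).
pose T n : tape -> real := tri (fun p => p == 0) (marks true n.+1 (K * n.+2))
   (fun p => if p <= n then y p else u p).
pose Inv n (c : conf craw) := c = @Conf craw (CSeekA true (y n.+1)) n.+1 (T n).
pose Good n (H : set (conf craw)) := (exists h, H h) /\
  forall h, H h -> forall k p, p <= n -> tp h k p = T n k p.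
have [H0 s0] := compress_ini h qh uy.
have [||H [t [HG sH tE]]] := @seg_omega craw Inv Good (@Conf craw (CSeekA true (y 1)) 1 (T 0)).
- by [].
- move=> n c ->.
  have nK : 2 * n.+2 <= K * n.+2 by rewrite leq_pmul2r.
  have [|H [sH ne HP]] := @loop true (y n.+1) n.+1 (K * n.+2) (T n TI) (T n TO) (ltn0Sn n).
    by clear -nK; lia.
  move: sH.
  set t1 := tri _ _ _; set t2 := tri _ _ _; rewrite (_ : t2 = T n.+1); last first.
    rewrite /t2 /T; congr tri; apply/funext => p /=.
    - by congr (marks _ _ _ p); rewrite [in RHS]mulnS addnC.
    - case: (eqVneq p n.+1) => [->|pn]; first by rewrite leqnn.
      by rewrite [in RHS]leq_eqVlt (negbTE pn) ltnS.
  move=> sH; exists H, (@Conf craw (CSeekA true (y n.+2)) n.+2 (T n.+1)); split=> //.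
  by move: sH; rewrite /= ifF ?uy //; clear -nK; lia.
exists (H0 `|` (fun h => exists n, H n h)), t.
have ne n : exists h, H n h by have [] := HG n.
have ev k p v : (forall n, p <= n -> T n k p = v) -> t k p = v.
  move=> Tv; apply: (limsup_eventually (N := p) (tE k p) ne) => n h' pn Hh.
  by have [_ HP] := HG n; rewrite (HP h' Hh k p pn) Tv.
split; first exact: seg_trans s0 sH.
- by apply/funext => p; apply: ev => n pn; rewrite /T /= pn.
- by rewrite (ev _ _ true).
Qed.

Lemma compile x y : gcomputes (G := G) i o x y -> outputs cittm x y.
Proof.
have K2 := @bsize_gt1 (trk G).
move=> [H [d [sH dh dy]]]; apply: craw_outputs.
have [H1 [t [s1 t1 t2 t3]]] := stretch x.
have [H2 s2] := emb_simulation sH.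
have [|H3 [t' [s3 ty ts]]] := @compress (st d) (K * hd d) y (emb_tape (tp d) TO) dh.
  by move=> n; rewrite -dy -[RHS]emb_tapeE /idx eqxx addn0.
have lim0 : gstep (@Conf craw CLim 0 t) = emb (Conf (gstart G) 0 (load i x)).
  rewrite (@gstepE craw _ _ _ (cmove (gstart G) 0 false) (tri true false (t TO 0)) Left
    (emb_tape (load i x))) /emb /= ?muln0 // ?t1 ?t2 //.
  move=> [[]|] p; last by rewrite /= t1; case: eqP.
    transitivity (t TO p); last by case: eqP => [->|].
    rewrite t3 /=; apply/existsP/andP => [[k /andP[/eqP <-]]|[/eqP p1 xp]].
      rewrite /load /idx; case: eqP => // ->.
      by rewrite (negbTE io).
    by exists i; rewrite /load eqxx /idx (negbTE io) eqxx p1.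
  by rewrite /= t2 if_same.
have lim1 : gstep (@Conf craw CLim 0 t') = @Conf craw CHalt 0 t'.
  by apply: (@gstep_same craw _ _ _ CHalt Left); rewrite /= ts.
exists (H1 `|` ([set @Conf craw CLim 0 t] `|` (H2 `|` (H3 `|` [set @Conf craw CLim 0 t'])))).
exists (@Conf craw CHalt 0 t'); split=> //.
apply: seg_trans s1 _; apply: (seg_trans (c2 := emb (Conf (gstart G) 0 (load i x)))).
  by rewrite -lim0; apply: seg_step.
apply: seg_trans s2 _; apply: seg_trans s3 _.
by rewrite -lim1; apply: seg_step.
Qed.

End Compile.

Lemma compilation (G : gm) (i o : trk G) : i != o ->
  exists M, forall x y, gcomputes (G := G) i o x y -> outputs M x y.
Proof. by move=> io; exists (cittm i o) => x y; apply: compile. Qed.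

(** * Multi-head transducers *)

(** In state [q] the head [mhead q] acts: [mact q b o], where [b] is the bit
    under it and [o] tells whether it is at the origin, gives the next state,
    the bit to be written on the output tape (if any), and the move (if any). *)
Record transducer := Transducer {
  mst : finType;
  mhd : finType;
  mstart : mst;
  mhead : mst -> mhd;
  mact : mst -> bool -> bool -> mst * option bool * option direction
}.

Section Transducers.
Variables (A : transducer) (x : real).

Record mconf := MConf { mq : mst A; mpos : mhd A -> nat; mout : real }.

Definition mstep (m : mconf) : mconf :=
  let h := mhead (mq m) in
  let p := mpos m h in
  let: (q, w, d) := mact (mq m) (x p) (p == 0) in
  MConf q (if d is Some d then [eta mpos m with h |-> move d p] else mpos m)
        (if w is Some b then [eta mout m with p |-> b] else mout m).

Inductive mwalk (I : set mconf) : mconf -> mconf -> Prop :=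
  | mwalk0 m : mwalk I m m
  | mwalkS m m' : I m -> mwalk I (mstep m) m' -> mwalk I m m'.

Lemma mwalk_trans I m2 m1 m3 : mwalk I m1 m2 -> mwalk I m2 m3 -> mwalk I m1 m3.
Proof. by elim=> // m m' Im _ IH /IH; apply: mwalkS. Qed.

Definition tOut : option (option (option (mhd A))) := None.
Definition tIn : option (option (option (mhd A))) := Some None.
Definition tOrg : option (option (option (mhd A))) := Some (Some None).
Definition tMark h : option (option (option (mhd A))) := Some (Some (Some h)).

Definition upd (T : eqType) (s : T -> bool) (k : T) (b : bool) : T -> bool :=
  fun l => if l == k then b else s l.

Definition tstate : finType := option (option (option (mst A * option (option (mhd A))))).
Definition sStart : tstate := None.
Definition sLim : tstate := Some None.
Definition sHalt : tstate := Some (Some None).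
Definition sSeek q : tstate := Some (Some (Some (q, None))).
Definition sHome q : tstate := Some (Some (Some (q, Some None))).
Definition sSet h q : tstate := Some (Some (Some (q, Some (Some h)))).

(** A transducer step is a round trip from the origin: seek the mark of the acting head, act, set
    the mark anew, walk home. The first limit stage leads to the halt, so the transducer is run for
    omega steps. *)
Definition tdelta (q : tstate) (s : option (option (option (mhd A))) -> bool) :
    tstate * (option (option (option (mhd A))) -> bool) * direction :=
  match q with
  | None => (sHome (mstart A),
      (fun k => match k with Some (Some _) => true | _ => s k end), Left)
  | Some None => (sHalt, s, Left)
  | Some (Some None) => (sHalt, s, Left)
  | Some (Some (Some (q, None))) =>
      let h := mhead q in
      if s (tMark h) then
        let: (q', w, d) := mact q (s tIn) (s tOrg) in
        let s' := if w is Some b then upd s tOut b else s in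
        if d is Some d then (sSet h q', upd s' (tMark h) false, d)
        else (sHome q', s', Left)
      else (sSeek q, s, Right)
  | Some (Some (Some (q, Some None))) =>
      if s tOrg then (sSeek q, s, Left) else (sHome q, s, Left)
  | Some (Some (Some (q, Some (Some h)))) => (sHome q, upd s (tMark h) true, Left)
  end.

Definition tgm : gm :=
  @GM (option (option (option (mhd A)))) tstate sStart sLim sHalt tdelta.

Definition ttape (ps : mhd A -> nat) (out : real) : trk tgm -> real := fun k =>
  match k with
  | None => out
  | Some None => x
  | Some (Some None) => fun p => p == 0
  | Some (Some (Some h)) => fun p => p == ps h
  end.

Definition temb (m : mconf) : conf tgm := @Conf tgm (sSeek (mq m)) 0 (ttape (mpos m) (mout m)).

Lemma go_home (I : set (conf tgm)) q ps out h : (forall q h, I (@Conf tgm q h (ttape ps out))) ->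
  walk I (@Conf tgm (sHome q) h (ttape ps out)) (temb (MConf q ps out)).
Proof.
move=> It; apply: walk_trans.
  apply: (@walk_left tgm _ (sHome q) _ 0 h) => // p /=.
  by case: p.
by apply: walkS => //; rewrite (@gstep_same tgm _ _ _ (sSeek q) Left) //; apply: walk0.
Qed.

Lemma temb_step m : exists H, [/\ seg H (temb m) (temb (mstep m)), exists h, H h &
  forall h : conf tgm, H h -> forall p, tp h tOut p = mout m p \/ tp h tOut p = mout (mstep m) p].
Proof.
case: m => q ps out; set m := MConf q ps out.
pose I : set (conf tgm) := [set h : conf tgm | forall p, tp h tOut p = mout m p \/ tp h tOut p = mout (mstep m) p].
pose h := mhead q; pose p := ps h.
have w1 : walk I (temb m) (@Conf tgm (sSeek q) p (ttape ps out)).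
  apply: walk_right => //; last by left.
  by move=> p' /= hp; rewrite ltn_eqF.
case E : (mact q (x p) (p == 0)) => [[q' w] d].
pose out' : real := if w is Some b then [eta out with p |-> b] else out.
pose ps' : mhd A -> nat := if d is Some d then [eta ps with h |-> move d p] else ps.
have mE : mstep m = MConf q' ps' out' by rewrite /mstep /= E.
have I' q1 h1 t : t tOut = out' -> I (@Conf tgm q1 h1 t).
  by move=> tE p1; right; rewrite mE /= tE.
pose s1 : trk tgm -> bool := if w is Some b then upd (fun k => ttape ps out k p) tOut b else fun k => ttape ps out k p.
pose c1 := @Conf tgm (sSeek q) p (ttape ps out).
suff w2 : walk I (gstep c1) (temb (mstep m)).
  have [H1 e1 I1] := walk_seg w1; have [H2 e2 I2] := walk_seg w2.
  exists (H1 `|` ([set c1] `|` H2)); split.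
  - by apply: seg_trans e1 _; apply: seg_trans e2; apply: seg_step.
  - by exists c1; right; left.
  - by move=> e [/I1|[->|/I2]] //; left.
rewrite mE; case: d E @ps' mE I' => [d|] E ps' mE I'; last first.
  rewrite (@gstepE tgm _ _ _ (sHome q') s1 Left (ttape ps out')).
  - by apply: go_home => *; apply: I'.
  - by rewrite /= eqxx E.
  - rewrite /s1 /out'; case: w {E mE I' out' s1} => [b|] k p'; last by case: (eqVneq p' p) => [->|].
    by case: k => [[[h'|]|]|] /=; case: (eqVneq p' p) => [E1|]; rewrite ?E1.
rewrite (@gstepE tgm _ _ _ (sSet h q') (upd s1 (tMark h) false) d
  (fun k => if k == tMark h then zeros else ttape ps out' k)).
- apply: walkS => //; first by apply: I'.
  rewrite (@gstepE tgm _ _ _ (sHome q')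
    (upd (fun k => (if k == tMark h then zeros else ttape ps out' k) (move d p)) (tMark h) true) Left (ttape ps' out')) //.
    by apply: go_home => *; apply: I'.
  move=> k p'; rewrite /upd; case: (eqVneq k (tMark h)) => [->|kh].
    by rewrite /= /ps' /= eqxx /zeros; case: (p' == move d p).
  rewrite (_ : ttape ps' out' k = ttape ps out' k); first by case: (eqVneq p' (move d p)) => [->|].
  apply/funext => p1; case: k kh => [[[h'|]|]|] //= kh.
  by rewrite /ps' /= ifF //; apply: contraNF kh => /eqP ->.
- by rewrite /= eqxx E.
- move=> k p'; rewrite /upd; case: (eqVneq k (tMark h)) => [->|kh].
    by rewrite /= /zeros; case: (eqVneq p' p).
  rewrite /s1 /out' /upd; case: w {E mE I' out' s1} => [b|]; last by case: (eqVneq p' p) => [->|].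
  by case: k kh => [[[h'|]|]|] //= kh; case: (eqVneq p' p) => [E1|]; rewrite ?E1.
Qed.

(** From block [n] on, the first [n] output cells have their final values, so the limsup is [v]. The
    walk of a block starts one step after [m], which makes the block inhabited. *)
Lemma transducer_gcomputes (v : real) (Inv : nat -> mconf -> Prop) :
  (exists2 m, mwalk setT (MConf (mstart A) (fun=> 0) zeros) m & Inv 0 m) ->
  (forall n m, Inv n m -> (forall p, p < n -> mout m p = v p) /\
     exists2 m', mwalk (fun m => forall p, p < n -> mout m p = v p) (mstep m) m' & Inv n.+1 m') ->
  gcomputes (G := tgm) tIn tOut x v.
Proof.
move=> [m0 w0 I0] IS.
have mwI I m m' : mwalk I m m' -> I m' -> I m by case.
have embw I m m' : mwalk I m m' -> I m' -> exists2 H, seg H (temb m) (temb m') &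
    forall h : conf tgm, H h -> forall p, exists2 m1, I m1 & tp h tOut p = mout m1 p.
  elim=> [e|m1 m2 I1 w12 IH] I2; first by exists set0 => //; apply: seg_refl.
  have [H sH HP] := IH I2; have [H1 [s1 _ H1P]] := temb_step m1.
  exists (H1 `|` H); first exact: seg_trans s1 sH.
  move=> h [/H1P h1|/HP //] p; case: (h1 p) => ->; first by exists m1.
  by exists (mstep m1) => //; apply: mwI w12 I2.
pose Good n (H : set (conf tgm)) := (exists h, H h) /\
  forall h, H h -> forall p, p < n -> tp h tOut p = v p.
pose CInv n (c : conf tgm) := exists2 m, Inv n m & c = temb m.
have [||H [t [HG sH tE]]] := @seg_omega tgm CInv Good (temb m0).
- by exists m0.
- move=> n _ [m Im ->]; have [mv [m' w' Im']] := IS n m Im.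
  have [mv' _] := IS _ _ Im'.
  have vI m1 : (forall p, p < n.+1 -> mout m1 p = v p) -> forall p, p < n -> mout m1 p = v p.
    by move=> m1v p pn; apply: m1v; apply: ltnW.
  have [H1 [s1 ne1 H1P]] := temb_step m.
  have [H2 s2 H2P] := embw _ _ _ w' (vI _ mv').
  have mv1 := mwI _ _ _ w' (vI _ mv').
  exists (H1 `|` H2), (temb m'); split.
  + exact: seg_trans s1 s2.
  + by have [h Hh] := ne1; exists h; left.
  + split; first by have [h Hh] := ne1; exists h; left.
    move=> h [/H1P h1|/H2P h2] p pn; first by case: (h1 p) => ->; [apply: mv|apply: mv1].
    by have [m1 m1v ->] := h2 p; apply: m1v.
  + by exists m'.
have ne n : exists h, H n h by have [] := HG n.
have [H0 s0 _] := embw _ _ _ w0 I.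
have start : gstep (Conf (gstart tgm) 0 (load tIn x : trk tgm -> real)) =
    @Conf tgm (sHome (mstart A)) 0 (ttape (fun=> 0) zeros).
  rewrite (@gstepE tgm _ _ _ (sHome (mstart A))
    (fun k => match k with Some (Some _) => true | _ => load tIn x k 0 end) Left
    (ttape (fun=> 0) zeros)) //.
  by case=> [[[h|]|]|] p /=; case: (eqVneq p 0) => [E1|]; rewrite ?E1.
have [H1 s1 _] : exists2 H, seg H (@Conf tgm (sHome (mstart A)) 0 (ttape (fun=> 0) zeros))
   (temb (MConf (mstart A) (fun=> 0) zeros)) & H `<=` setT.
  by apply: walk_seg; apply: go_home.
exists ([set Conf (gstart tgm) 0 (load tIn x : trk tgm -> real)] `|` (H1 `|` (H0 `|`
  ((fun h => exists n, H n h) `|` [set @Conf tgm sLim 0 t])))).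
exists (@Conf tgm sHalt 0 t); split=> //; last first.
  apply/funext => p; apply: (limsup_eventually (N := p.+1) (tE _ _) ne) => n h pn Hh.
  by have [_] := HG n; apply.
apply: seg_trans; first by apply: seg_step.
rewrite start; apply: seg_trans s1 _; apply: seg_trans s0 _; apply: seg_trans sH _.
suff <- : gstep (@Conf tgm sLim 0 t) = @Conf tgm sHalt 0 t by apply: seg_step.
exact: (@gstep_same tgm _ _ _ sHalt Left).
Qed.

End Transducers.

Arguments tIn {A}.
Arguments tOut {A}.

Lemma transduction (A : transducer) :
  exists M, forall x v (Inv : nat -> mconf A -> Prop),
  (exists2 m, mwalk x setT (MConf (mstart A) (fun=> 0) zeros) m & Inv 0 m) ->
  (forall n m, Inv n m -> (forall p, p < n -> mout m p = v p) /\
     exists2 m', mwalk x (fun m => forall p, p < n -> mout m p = v p) (mstep x m) m' &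
                 Inv n.+1 m') ->
  outputs M x v.
Proof.
have [M MP] := @compilation (tgm A) tIn tOut isT.
by exists M => x v Inv I0 IS; apply: MP; apply: transducer_gcomputes I0 IS.
Qed.

(** * Composition and iteration *)

Section Phases.
Variables (V Ph : finType).
Let U : finType := (tape + V)%type.
Variables (runs : Ph -> bool) (M : Ph -> ittm) (phi : Ph -> (U -> bool) -> U -> bool).
Variables (next : Ph -> (U -> bool) -> option Ph) (fin : Ph -> (U -> bool) -> U -> bool).
Variables (p0 pomega : Ph).

(** Each phase has a flag track, marked in cell 0 while the phase is on. A limit inside a phase
    leaves exactly one flag up, which identifies it; a limit of cycles through several phases leaves
    several up and leads to [pomega]. *)
Definition ptrk : finType := (U + Ph)%type.
Definition pstate : finType := option (option (Ph + Ph + {p : Ph & state (M p)})).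
Definition pLim : pstate := None.
Definition pHalt : pstate := Some None.
Definition pGo p : pstate := Some (Some (inl (inl p))).
Definition pSweep p : pstate := Some (Some (inl (inr p))).
Definition pRun p (q : state (M p)) : pstate :=
  Some (Some (inr (existT (fun p => state (M p) : Type) p q))).

Definition psym (u : U -> bool) (f : Ph -> bool) (k : ptrk) : bool :=
  match k with inl k => u k | inr p => f p end.

(** Branching and the final correction look at cell 0 only, the one cell where the codes of 0 and 1
    differ. *)
Definition pgoto p (s : ptrk -> bool) : pstate * (ptrk -> bool) * direction :=
  if next p (s \o inl) is Some p' then (pGo p', s, Left)
  else (pHalt, psym (fin p (s \o inl)) (s \o inr), Left).

Definition pdelta (q : pstate) (s : ptrk -> bool) : pstate * (ptrk -> bool) * direction :=
  match q with
  | None =>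
      if [pick p | [forall p', s (inr p') == (p' == p)]] is Some p then
        if runs p then (pRun (limit (M p)), s, Left) else pgoto p s
      else (pGo pomega, s, Left)
  | Some None => (pHalt, s, Left)
  | Some (Some (inl (inl p))) =>
      if runs p then (pRun (start (M p)), psym (s \o inl) (eq_op^~ p), Left)
      else (pSweep p, psym (phi p (s \o inl)) (eq_op^~ p), Right)
  | Some (Some (inl (inr p))) => (pSweep p, psym (phi p (s \o inl)) (s \o inr), Right)
  | Some (Some (inr (existT p q))) =>
      if q == halt (M p) then
        if s (inr p) then pgoto p s else (pRun q, s, Left)
      else
        let: (q', w, d) := gdelta (g := gm_of (M p)) q (fun k => s (inl (inl k))) in
        (pRun q', psym (fun k => match k with inl k => w k | inr v => s (inl (inr v)) end)
                       (s \o inr), d)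
  end.

Definition pgm : gm := @GM ptrk pstate (pGo p0) pLim pHalt pdelta.

Implicit Types t : trk pgm -> real.

Definition pend p t : conf pgm :=
  if next p (fun k => t (inl k) 0) is Some p' then @Conf pgm (pGo p') 0 t
  else @Conf pgm pHalt 0 (fun k n => if n == 0 then
         psym (fin p (fun k => t (inl k) 0)) (fun p => t (inr p) 0) k else t k n).

(** When [M p] has halted, cell 0 is found by walking left to the flag of [p], so no flag may be
    marked elsewhere. *)
Definition clean t := forall p n, 0 < n -> t (inr p) n = false.

Definition hot p t := forall p', t (inr p') 0 = (p' == p).

Lemma pgoto_step q p t : pdelta q (fun k => t k 0) = pgoto p (fun k => t k 0) ->
  gstep (@Conf pgm q 0 t) = pend p t.
Proof.
rewrite /pgoto /pend /comp /=; case: (next p _) => [p'|] E.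
  exact: (@gstep_same pgm _ _ _ (pGo p') Left).
exact: (@gstepE pgm _ _ _ pHalt _ Left _ E).
Qed.

Lemma pick_hot p t : hot p t ->
  [pick p | [forall p', t (inr p') 0 == (p' == p)]] = Some p.
Proof.
move=> ht; case: pickP => [p1 /forallP/(_ p)|/(_ p)/negbT/forallPn[p' /eqP[]]//].
by rewrite ht eqxx => /eqP/esym/eqP ->.
Qed.

Lemma sweep_phase p t : ~~ runs p -> exists H t',
  [/\ seg H (@Conf pgm (pGo p) 0 t) (pend p t'),
      exists2 h, H h & tp h (inr p) 0,
      clean t -> clean t', hot p t' &
      forall k n, t' (inl k) n = phi p (fun k => t (inl k) n) k].
Proof.
move=> rp.
pose T n : trk pgm -> real := fun k m => if m < n then
   psym (phi p (fun k => t (inl k) m)) (fun p' => if m == 0 then p' == p else t (inr p') m) k else t k m.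
pose c n := @Conf pgm (if n == 0 then pGo p else pSweep p) n (T n).
have cS n : gstep (c n) = c n.+1.
  rewrite /c (@gstepE pgm _ _ _ (pSweep p) (fun k => T n.+1 k n) Right (T n.+1)) //.
    case: n => [|n] /=; first by rewrite (negbTE rp); congr (_, _, _); apply/funext => -[].
    congr (_, _, _); apply/funext => -[k|k] /=; rewrite /T ltnSn ltnn //.
  move=> k m; case: (eqVneq m n) => [->//|mn].
  by rewrite /T ltnS leq_eqVlt (negbTE mn).
have [||H [t' [HG sH tE]]] := @seg_omega pgm (fun n d => d = c n) (fun n H => H = [set c n]) (c 0).
- by [].
- move=> n _ ->; exists [set c n], (c n.+1); split=> //; last by exists (c n).
  by rewrite -cS; apply: seg_step; rewrite /c /=; case: ifP.
have t'E k m : t' k m = psym (phi p (fun k => t (inl k) m)) (fun p' => if m == 0 then p' == p else t (inr p') m) k.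
  apply: (limsup_eventually (N := m.+1) (tE k m)) => [n|n h mn].
    by rewrite HG; exists (c n).
  by rewrite HG => -> /=; rewrite /T mn.
exists ((fun h => exists n, H n h) `|` [set @Conf pgm pLim 0 t']), t'.
have ht : hot p t' by move=> p'; rewrite t'E.
split=> //.
- have -> : @Conf pgm (pGo p) 0 t = c 0 by congr Conf; apply/funext => k; apply/funext.
  apply: seg_trans sH _; rewrite -(@pgoto_step pLim); first exact: seg_step.
  by rewrite /= (pick_hot ht) (negbTE rp).
- by exists (@Conf pgm pLim 0 t'); [right|rewrite /= ht].
- by move=> ct p' n n0; rewrite t'E /= gtn_eqF // ct.
Qed.

(** The machine is simulated on its three tracks with all others frozen; at its limit stages the
    single flag leads back into its own limit state. *)
Lemma run_phase p t x y : runs p -> outputs (M p) x y -> clean t ->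
  (forall k, t (inl (inl k)) = load (None : tape) x k) ->
  exists H t',
  [/\ seg H (@Conf pgm (pGo p) 0 t) (pend p t'),
      exists2 h, H h & tp h (inr p) 0,
      clean t', t' (inl (inl (Some true))) = y &
      forall v, t' (inl (inr v)) = t (inl (inr v))].
Proof.
move=> rp /outputs_gcomputes [H [d [sH dh <-]]] ct tx.
pose T (s : tape -> real) : trk pgm -> real := fun k =>
  match k with
  | inl (inl k) => s k
  | inl (inr v) => t (inl (inr v))
  | inr p' => fun n => (n == 0) && (p' == p)
  end.
pose f (c : conf (gm_of (M p))) := @Conf pgm (pRun (st c)) (hd c) (T (tp c)).
have hT s : hot p (T s) by move=> p'.
have cT s : clean (T s) by move=> p' [|n].
have [|||H' sH'] := @simulation _ _ f _ _ _ H _ d sH.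
- case=> [[k|v]|p'] n; last by right; exists ((n == 0) && (p' == p)).
    by left; exists k, n.
  by right; exists (t (inl (inr v)) n).
- move=> c ch; exists [set f c]; split.
  + suff <- : gstep (f c) = f (gstep c) by apply: seg_step.
    rewrite /f; case: c ch => q n s ch /=.
    case E : (gdelta (g := gm_of (M p)) q (fun k => s k n)) => [[q' w] e].
    have -> : gstep (@Conf (gm_of (M p)) q n s) =
        Conf q' (move e n) (fun k m => if m == n then w k else s k m) by apply: (gstepE E).
    apply: (@gstepE pgm _ _ _ (pRun q')
       (psym (fun k => match k with inl k => w k | inr v => t (inl (inr v)) n end)
          (fun p' => (n == 0) && (p' == p))) e).
      by move: E; rewrite /= (negbTE ch) /= => ->.
    by case=> [[k|v]|p'] m //=; case: (eqVneq m n) => [->|].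
  + by exists (f c).
  + by move=> h -> k n; left.
- move=> c cl c0; exists [set @Conf pgm pLim 0 (T (tp c))]; last by move=> h ->.
  suff fc : gstep (@Conf pgm pLim 0 (T (tp c))) = f c.
    by have := @seg_step pgm (@Conf pgm pLim 0 (T (tp c))) isT; rewrite fc.
  rewrite (@gstep_same pgm _ _ _ (pRun (limit (M p))) Left); first by rewrite /f cl c0.
  by rewrite /= (pick_hot (hT (tp c))) rp.
have start : gstep (@Conf pgm (pGo p) 0 t) = f (Conf (gstart (gm_of (M p))) 0 (load (None : tape) x)).
  apply: (@gstepE pgm _ _ _ _ (fun k => T (load (None : tape) x) k 0) Left).
    rewrite /= rp; congr (_, _, _).
    by apply/funext => -[[k|v]|p'] //=; rewrite tx.
  case=> [[k|v]|p'] m; case: (eqVneq m 0) => [->//|m0] //=; first by rewrite tx.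
  by rewrite ct //; case: (m) m0.
have [H2 s2 _] : exists2 H, seg H (f d) (@Conf pgm (pRun (halt (M p))) 0 (T (tp d))) & H `<=` setT.
  apply: walk_seg; rewrite /f dh; apply: walk_left => // n /= n0.
  by rewrite eqxx ifF //; case: (n) n0.
set c1 := @Conf pgm (pGo p) 0 t; set c2 := @Conf pgm (pRun (halt (M p))) 0 (T (tp d)).
exists ([set c1] `|` (H' `|` (H2 `|` [set c2]))), (T (tp d)).
split=> //.
- apply: seg_trans; first exact: seg_step.
  rewrite start; apply: seg_trans sH' _; apply: seg_trans s2 _.
  rewrite -(@pgoto_step (pRun (halt (M p)))); first exact: seg_step.
  by rewrite /= !eqxx.
- by exists c2; [right; right; right|rewrite /= eqxx].
Qed.

Lemma omega_step t p1 p2 : p1 != p2 -> t (inr p1) 0 -> t (inr p2) 0 ->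
  gstep (@Conf pgm pLim 0 t) = @Conf pgm (pGo pomega) 0 t.
Proof.
move=> p12 t1 t2; apply: (@gstep_same pgm _ _ _ (pGo pomega) Left) => /=.
case: pickP => // p /forallP hp; case/eqP: p12.
by have := hp p1; have := hp p2; rewrite t1 t2 => /eqP/esym/eqP -> /eqP/esym/eqP ->.
Qed.

End Phases.

Section Composition.
Variables (M1 M2 : ittm).

(** The phases in order: [None] runs [M1], [Some false] moves the result to the input track and
    blanks the others, [Some true] runs [M2]. *)
Let runs (p : option bool) := p != Some false.
Let mach (p : option bool) := if p is None then M1 else M2.
Let phi (_ : option bool) (u : (tape + void)%type -> bool) (k : (tape + void)%type) :=
  if k is inl None then u (inl (Some true)) else false.
Let next (p : option bool) (_ : (tape + void)%type -> bool) : option (option bool) :=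
  match p with
  | None => Some (Some false)
  | Some false => Some (Some true)
  | Some true => None
  end.
Let fin (_ : option bool) (u : (tape + void)%type -> bool) := u.
Let cgm := @pgm void (option bool) runs mach phi next fin None None.

Lemma composition : exists M, forall x y z,
  outputs M1 x y -> outputs M2 y z -> outputs M x z.
Proof.
have [M MP] := @compilation cgm (inl (inl None)) (inl (inl (Some true))) isT.
exists M => x y z xy yz; apply: MP.
have runP := @run_phase _ _ runs mach phi next fin None None.
have sweepP := @sweep_phase _ _ runs mach phi next fin None None.
have [||||H1 [t1 [s1 _ c1 y1 _]]] :=
  runP None (load (inl (inl None) : trk cgm) x) x y => //.
have [|H2 [t2 [s2 _ /(_ c1) c2 _ t2E]]] := sweepP (Some false) t1 => //.
have [||||H3 [t3 [s3 _ c3 z3 _]]] := runP (Some true) t2 y z => //.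
  by move=> k; apply/funext => n; rewrite t2E; case: k => [[]|] //=; rewrite y1.
exists (H1 `|` (H2 `|` H3)); eexists; split.
- by apply: seg_trans s1 _; apply: seg_trans s2 s3.
- by [].
- by apply/funext => n /=; rewrite /fin z3; case: n.
Qed.

End Composition.

Section Iteration.
Variables (P F : ittm) (pr : real -> bool) (f : real -> real).
Hypothesis P_pr : forall x, outputs P x (natcode (pr x)).
Hypothesis F_f : forall x, outputs F x (f x).

Let U := (tape + bool)%type.
Notation kX := (inr false).
Notation kOut := (inr true).

(** The current real is kept on the track [kX].  The cycle of phases is: copy
    it to the work tracks, run [P], copy it again, run [F], store the result.
    At the limit of infinitely many cycles several phase flags are raised, which
    starts the phase [pEnd]. *)
Let Ph : finType := (bool * option bool)%type.
Notation pCopyP := (false, None).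
Notation pP := (false, Some false).
Notation pCopyF := (false, Some true).
Notation pF := (true, Some false).
Notation pStore := (true, Some true).
Notation pEnd := (true, None).

Let runs (p : Ph) := p.2 == Some false.
Let mach (p : Ph) := if p.1 then F else P.
Let phi (p : Ph) (u : U -> bool) (k : U) : bool :=
  match p, k with
  | pEnd, _ => false
  | pStore, kX => u (inl (Some true))
  | _, inl None => u kX
  | _, inl _ => false
  | _, _ => u k
  end.
Let next (p : Ph) (u : U -> bool) : option Ph :=
  match p with
  | pCopyP => Some pP
  | pP => if u (inl (Some true)) then Some pCopyF else None
  | pCopyF => Some pF
  | pF => Some pStore
  | pStore => Some pCopyP
  | pEnd => None
  end.
(** The sweep of [pEnd] blanks everything, so one bit in cell 0 of [kOut] yields the code of 1.
    After a failed test [kOut] is still blank, which is the code of 0. *)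
Let fin (p : Ph) (u : U -> bool) (k : U) : bool :=
  if p is pEnd then k == kOut else u k.
Let igm := @pgm bool Ph runs mach phi next fin pCopyP pEnd.

Let loaded (y : real) (t : trk igm -> real) :=
  [/\ clean t, t (inl kX) = y & t (inl kOut) = zeros].

Let runP := @run_phase _ _ runs mach phi next fin pCopyP pEnd.
Let sweepP := @sweep_phase _ _ runs mach phi next fin pCopyP pEnd.

Let cycle_P y t : loaded y t -> exists H (t' : trk igm -> real),
  [/\ seg H (@Conf igm (pGo _ pCopyP) 0 t) (pend (pP : Ph) t'),
      exists2 h, H h & tp h (inr pCopyP) 0,
      exists2 h, H h & tp h (inr pP) 0,
      loaded y t' & t' (inl (inl (Some true))) = natcode (pr y)].
Proof.
move=> [ct tX tO].
have [|H1 [t1 [s1 f1 /(_ ct) c1 _ t1E]]] := @sweepP pCopyP t => //.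
have [||||H2 [t2 [s2 f2 c2 o2 t2E]]] := @runP pP t1 y (natcode (pr y)) => //.
  by move=> k; apply/funext => n; rewrite t1E; case: k => [[]|] //=; rewrite tX.
exists (H1 `|` H2), t2; split => //.
- exact: seg_trans s1 s2.
- by have [h ? ?] := f1; exists h => //; left.
- by have [h ? ?] := f2; exists h => //; right.
- split=> //; rewrite t2E; apply/funext => n; rewrite t1E /=; first by rewrite tX.
  by rewrite tO.
Qed.

Let cycle y t : loaded y t -> pr y -> exists H t',
  [/\ seg H (@Conf igm (pGo _ pCopyP) 0 t) (@Conf igm (pGo _ pCopyP) 0 t'),
      exists2 h, H h & tp h (inr pCopyP) 0,
      exists2 h, H h & tp h (inr pP) 0 & loaded (f y) t'].
Proof.
move=> /cycle_P [H1 [t1 [s1 f1 g1 [c1 X1 O1] o1]]] pry.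
move: s1; rewrite /pend /= o1 pry /= => s1.
have [|H2 [t2 [s2 f2 /(_ c1) c2 _ t2E]]] := @sweepP pCopyF t1 => //.
have [||||H3 [t3 [s3 f3 c3 o3 t3E]]] := @runP pF t2 y (f y) => //.
  by move=> k; apply/funext => n; rewrite t2E; case: k => [[]|] //=; rewrite X1.
have [|H4 [t4 [s4 f4 /(_ c3) c4 _ t4E]]] := @sweepP pStore t3 => //.
exists (H1 `|` (H2 `|` (H3 `|` H4))), t4; split.
- by apply: seg_trans s1 _; apply: seg_trans s2 _; apply: seg_trans s3 s4.
- by have [h ? ?] := f1; exists h => //; left.
- by have [h ? ?] := g1; exists h => //; left.
- split=> //; apply/funext => n; rewrite t4E /=; first by rewrite o3.
  by rewrite t3E t2E /= O1.
Qed.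

Lemma iteration_gcomputes x :
  gcomputes (G := igm) (inl kX) (inl kOut) x (natcode `[< forall i, pr (iter i f x) >]).
Proof.
have l0 : loaded x (load (inl kX : trk igm) x) by [].
case: asboolP => [all_pr|/existsNP].
  pose Inv n (c : conf igm) := exists2 t, loaded (iter n f x) t & c = @Conf igm (pGo _ pCopyP) 0 t.
  pose Good (n : nat) (H : set (conf igm)) :=
    (exists2 h, H h & tp h (inr pCopyP) 0) /\ exists2 h, H h & tp h (inr pP) 0.
  have [||H [t [HG sH tE]]] := @seg_omega igm Inv Good (@Conf igm (pGo _ pCopyP) 0 (load (inl kX : trk igm) x)).
  - by exists (load (inl kX : trk igm) x).
  - move=> n _ [t lt ->]; have [H [t' [sH f1 f2 lt']]] := cycle lt (all_pr n).
    exists H, (@Conf igm (pGo _ pCopyP) 0 t'); split=> //; last by exists t'.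
    by have [h] := f1; exists h.
  (* Two different flags go up in every cycle, hence both are up at the limit and [omega_step]
     applies. *)
  have t1 : t (inr pCopyP) 0.
    by apply/tE => N; have [[h Hh th] _] := HG N; exists N, h.
  have t2 : t (inr pP) 0.
    by apply/tE => N; have [_ [h Hh th]] := HG N; exists N, h.
  have [|H2 [t' [s2 _ _ _ t'E]]] := @sweepP pEnd t => //.
  exists ((fun h => exists n, H n h) `|` ([set @Conf igm (pLim _) 0 t] `|` H2)); eexists; split.
  - apply: seg_trans sH _; apply: seg_trans s2; rewrite -(@omega_step _ _ runs mach phi next fin pCopyP pEnd _ pCopyP pP _ t1 t2) //.
    exact: seg_step.
  - by [].
  - by apply/funext => -[|n] /=; rewrite ?t'E.
move=> no.
have {no} [n nn nmin] : exists2 n, ~~ pr (iter n f x) & forall m, m < n -> pr (iter m f x).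
  have ex : exists n, ~~ pr (iter n f x) by have [n /negP] := no; exists n.
  case: (ex_minnP ex) => n nn nmin; exists n => // m; apply: contraTT => /nmin.
  by rewrite -leqNgt.
have [H [t [sH lt]]] : exists H t, seg H (@Conf igm (pGo _ pCopyP) 0 (load (inl kX : trk igm) x))
    (@Conf igm (pGo _ pCopyP) 0 t) /\ loaded (iter n f x) t.
  elim: n nmin {nn} => [|n IH] nmin.
    by exists set0, (load (inl kX : trk igm) x); split=> //; apply: seg_refl.
  have [m mn|H [t [sH lt]]] := IH; first by apply: nmin; apply: ltnW.
  have [H' [t' [sH' _ _ lt']]] := cycle lt (nmin n (ltnSn n)).
  by exists (H `|` H'), t'; split=> //; apply: seg_trans sH sH'.
have [H2 [t2 [s2 _ _ [_ _ O2] o2]]] := cycle_P lt.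
move: s2; rewrite /pend /= o2 (negbTE nn) /= => s2.
exists (H `|` H2); eexists; split.
- exact: seg_trans sH s2.
- by [].
- by apply/funext => -[|m] /=; rewrite O2.
Qed.

Lemma iteration :
  exists M, forall x, outputs M x (natcode `[< forall i, pr (iter i f x) >]).
Proof.
have [M MP] := @compilation igm (inl kX) (inl kOut) isT.
by exists M => x; apply: MP; apply: iteration_gcomputes.
Qed.

End Iteration.

(** * Rearranging the bits of codes *)

Definition agree (v : real) (n : nat) (out : real) : Prop := forall p, p < n -> out p = v p.

Lemma mstepE (A : transducer) x q ps out q' w d ps' out' :
  mact q (x (ps (mhead q))) (ps (mhead q) == 0) = (q', w, d) ->
  (forall h, ps' h = if d is Some d then if h == mhead q then move d (ps h) else ps h
                     else ps h) ->
  (forall p, out' p = if w is Some b then if p == ps (mhead q) then b else out p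
                      else out p) ->
  @mstep A x (MConf q ps out) = MConf q' ps' out'.
Proof.
rewrite /mstep /= => -> psE outE; congr MConf; apply/funext => k.
  by rewrite psE; case: d {psE} => //= d; case: eqP => [->|].
by rewrite outE; case: w {outE}.
Qed.

Lemma mwalk_neq (A : transducer) x I (m m' : mconf A) :
  mwalk x I m m' -> m <> m' -> mwalk x I (mstep x m) m'.
Proof. by case. Qed.

(** Straight-line programs, for rearrangements of bits in a fixed periodic pattern: [pre] is
    executed once, then [body] over and over. *)
Inductive instr := Emit of bool | Copy of bool | Advance of bool.

Section StraightLine.
Variables (pre body : seq instr).

Let prog := pre ++ body.
Let pc := 'I_(size prog).+1.

(** The heads [Some h] read and the head [None] writes; the second component
    of a state is a bit about to be written. *)
Definition line_head (q : pc * option bool) : option bool :=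
  if q.2 is Some _ then None else
  match nth (Emit false) prog q.1 with
  | Emit _ => None
  | Copy h | Advance h => Some h
  end.

Definition line_act (q : pc * option bool) (b o : bool) :
    pc * option bool * option bool * option direction :=
  let nxt : pc := inord q.1.+1 in
  if q.2 is Some e then ((nxt, None), Some e, Some Right) else
  if q.1 == size prog :> nat then ((inord (size pre), None), None, None) else
  match nth (Emit false) prog q.1 with
  | Emit e => ((nxt, None), Some e, Some Right)
  | Copy _ => ((q.1, Some b), None, None)
  | Advance _ => ((nxt, None), None, Some Right)
  end.

Definition line : transducer :=
  @Transducer (pc * option bool)%type (option bool) (ord0, None) line_head line_act.

Variable x : real.

Fixpoint exec (l : seq instr) (ps : bool -> nat) : (bool -> nat) * seq bool :=
  match l with
  | [::] => (ps, [::])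
  | Emit b :: l => let: (ps', s) := exec l ps in (ps', b :: s)
  | Copy h :: l => let: (ps', s) := exec l ps in (ps', x (ps h) :: s)
  | Advance h :: l => exec l (fun k => if k == h then (ps k).+1 else ps k)
  end.

Definition lpos (ps : bool -> nat) (w : nat) (h : option bool) : nat :=
  if h is Some h then ps h else w.

Definition lconf i ps w out : mconf line :=
  @MConf line ((inord i : pc), None) (lpos ps w) out.

Lemma exec_walk v N l l1 l2 ps w out : prog = l1 ++ l ++ l2 ->
  N <= w -> agree v w out ->
  (forall j, j < size (exec l ps).2 -> nth false (exec l ps).2 j = v (w + j)) ->
  exists2 out', agree v (w + size (exec l ps).2) out' &
  mwalk x (fun m => agree v N (mout m)) (lconf (size l1) ps w out)
    (lconf (size l1 + size l) (exec l ps).1 (w + size (exec l ps).2) out').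
Proof.
elim: l l1 ps w out => [|i l IH] l1 ps w out E Nw ag sv.
  by exists out; rewrite /= !addn0 //; apply: mwalk0.
have szl : size l1 < size prog by rewrite E !size_cat /=; lia.
have ni : nth (Emit false) prog (inord (size l1) : pc) = i.
  by rewrite inordK; [rewrite E nth_cat ltnn subnn|lia].
have E' : prog = rcons l1 i ++ l ++ l2 by rewrite cat_rcons.
have agN out1 : agree v w out1 -> agree v N out1.
  by move=> a p pN; apply: a; apply: leq_trans Nw.
have emit b : v w = b -> agree v w.+1 (fun p => if p == w then b else out p).
  by move=> <- p; rewrite ltnS leq_eqVlt; case: (eqVneq p w) => [->|pw] //= /ag.
have sE : size (rcons l1 i) + size l = size l1 + size (i :: l).
  by rewrite size_rcons /= addSnnS.
have neq : (inord (size l1) : pc) == size prog :> nat = false.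
  by rewrite inordK; lia.
have nxt : (inord (inord (size l1) : pc).+1 : pc) = inord (size (rcons l1 i)).
  by rewrite size_rcons inordK //; lia.
case: i ni E E' sv emit sE nxt => [b|h|h] ni E E' sv emit sE nxt.
- have vw : v w = b.
    by have := sv 0; rewrite /= addn0; case: (exec l ps) => ps' s /= <-.
  have [||||out' ag' wk] := IH (rcons l1 (Emit b)) ps w.+1 (fun p => if p == w then b else out p).
  + by [].
  + exact: leqW.
  + exact: emit.
  + by move=> j js; have := sv j.+1; rewrite /= addnS -addSn; case: (exec l ps) js => ps' s /= js; apply.
  exists out'; first by move: ag'; rewrite /=; case: (exec l ps) => ps' s /=; rewrite addnS -addSn.
  rewrite -sE; apply: mwalkS; first exact: agN.
  rewrite (@mstepE line _ _ _ _ (inord (size (rcons l1 (Emit b))), None) (Some b) (Some Right)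
    (lpos ps w.+1) (fun p => if p == w then b else out p)).
  + by move: wk; rewrite /=; case: (exec l ps) => ps' s /=; rewrite addnS -addSn.
  + by rewrite /= /line_act /= neq ni nxt.
  + by rewrite /= /line_head /= ni => -[].
  + by rewrite /= /line_head /= ni.
- have vw : v w = x (ps h).
    by have := sv 0; rewrite /= addn0; case: (exec l ps) => ps' s /= <-.
  have [||||out' ag' wk] := IH (rcons l1 (Copy h)) ps w.+1 (fun p => if p == w then x (ps h) else out p).
  + by [].
  + exact: leqW.
  + exact: emit.
  + by move=> j js; have := sv j.+1; rewrite /= addnS -addSn; case: (exec l ps) js => ps' s /= js; apply.
  exists out'; first by move: ag'; rewrite /=; case: (exec l ps) => ps' s /=; rewrite addnS -addSn.
  rewrite -sE; apply: mwalkS; first exact: agN.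
  rewrite (@mstepE line _ _ _ _ (inord (size l1), Some (x (ps h))) None None
    (lpos ps w) out) //; last first.
    by rewrite /= /line_act /line_head /= neq ni.
  apply: mwalkS; first exact: agN.
  rewrite (@mstepE line _ _ _ _ (inord (size (rcons l1 (Copy h))), None) (Some (x (ps h))) (Some Right)
    (lpos ps w.+1) (fun p => if p == w then x (ps h) else out p)) //.
  + by move: wk; rewrite /=; case: (exec l ps) => ps' s /=; rewrite addnS -addSn.
  + by rewrite /= /line_act /= nxt.
  + by case.
- have [||||out' ag' wk] := IH (rcons l1 (Advance h)) (fun k => if k == h then (ps k).+1 else ps k) w out => //.
  exists out' => //; rewrite -sE; apply: mwalkS; first exact: agN.
  rewrite (@mstepE line _ _ _ _ (inord (size (rcons l1 (Advance h))), None) None (Some Right)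
    (lpos (fun k => if k == h then (ps k).+1 else ps k) w) out) //.
  + by rewrite /= /line_act /= neq ni nxt.
  + by rewrite /= /line_head /= ni => -[k|].
Qed.

(** A round of the body emits [c > 0] bits, so after [n] rounds at least [n] output cells are final,
    as [transduction] demands. *)
Lemma line_inv v (pos : nat -> bool -> nat) c : 0 < c ->
  let s0 := exec pre (fun=> 0) in let s n := exec body (pos n) in
  s0.1 = pos 0 -> (forall j, j < size s0.2 -> nth false s0.2 j = v j) ->
  (forall n, (s n).1 = pos n.+1) -> (forall n, size (s n).2 = c) ->
  (forall n j, j < c -> nth false (s n).2 j = v (size s0.2 + c * n + j)) ->
  let Inv n m := exists2 out, agree v (size s0.2 + c * n) out &
     m = lconf (size pre) (pos n) (size s0.2 + c * n) out in
  (exists2 m, mwalk x setT (MConf (mstart line) (fun=> 0) zeros) m & Inv 0 m) /\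
  forall n m, Inv n m -> (forall p, p < n -> mout m p = v p) /\
     exists2 m', mwalk x (fun m => forall p, p < n -> mout m p = v p) (mstep x m) m' & Inv n.+1 m'.
Proof.
move=> c0 s0 s p0 v0 pS sz vS Inv; split.
  have [|||//|out ag wk] := @exec_walk v 0 pre [::] body (fun=> 0) 0 zeros.
  - by [].
  - by [].
  - by [].
  exists (lconf (size pre) (pos 0) (size s0.2 + c * 0) out).
    rewrite muln0 addn0 -p0; move: wk; rewrite /= !add0n => wk.
    have -> : MConf (mstart line) (fun=> 0) zeros = lconf 0 (fun=> 0) 0 zeros.
      rewrite /lconf; congr MConf; last by apply/funext => -[].
      by congr pair; apply/val_inj; rewrite /= inordK.
    elim: wk => [m|m m' _ _ IH]; first exact: mwalk0.
    exact: mwalkS.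
  by exists out => //; rewrite muln0 addn0.
move=> n m [out ag ->]; set w := size s0.2 + c * n.
have nw : n <= w by rewrite /w; apply: leq_trans (leq_addl _ _); rewrite leq_pmull.
split; first by move=> p pn; apply: ag; apply: leq_trans nw.
have [|||//|out' ag' wk] := @exec_walk v n body pre [::] (pos n) w out; rewrite ?cats0 //.
  by move=> j; rewrite sz => jc; apply: vS.
move: ag' wk; rewrite sz pS -size_cat -/prog => ag' wk.
have wE : size s0.2 + c * n.+1 = w + c by rewrite mulnS /w; lia.
exists (lconf (size pre) (pos n.+1) (size s0.2 + c * n.+1) out'); last by exists out'; rewrite ?wE.
rewrite wE; have loop : mstep x (lconf (size prog) (pos n.+1) (w + c) out') = lconf (size pre) (pos n.+1) (w + c) out'.
  apply: (@mstepE line _ _ _ _ _ None None) => //.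
  by rewrite /= /line_act /= inordK // eqxx.
have wk2 : mwalk x (fun m => agree v n (mout m)) (lconf (size prog) (pos n.+1) (w + c) out')
    (lconf (size pre) (pos n.+1) (w + c) out').
  rewrite -loop; apply: mwalkS; last exact: mwalk0.
  by move=> p pn; apply: ag'; lia.
(* The writing head has moved, so the walk is not empty and its first step can be split off. *)
apply: mwalk_neq (mwalk_trans wk wk2) _.
by move=> /(congr1 (fun m : mconf line => mpos m None)) /=; lia.
Qed.

End StraightLine.

Lemma line_outputs (pre body : seq instr) :
  exists M, forall x v (pos : nat -> bool -> nat) c,
  let s0 := exec x pre (fun=> 0) in let s n := exec x body (pos n) in
  0 < c -> s0.1 = pos 0 -> (forall j, j < size s0.2 -> nth false s0.2 j = v j) ->
  (forall n, (s n).1 = pos n.+1) -> (forall n, size (s n).2 = c) ->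
  (forall n j, j < c -> nth false (s n).2 j = v (size s0.2 + c * n + j)) ->
  outputs M x v.
Proof.
have [M MP] := transduction (line pre body); exists M => x v pos c s0 s c0 p0 v0 pS sz vS.
by have [I0 IS] := line_inv c0 p0 v0 pS sz vS; apply: MP I0 IS.
Qed.

Lemma bool_funext (T : Type) (f g : bool -> T) : f true = g true -> f false = g false -> f = g.
Proof. by move=> ft ff; apply/funext => -[]. Qed.

Lemma affine_map (a b : nat) : exists M, forall x, outputs M x (fun n => x (a * n + b)).
Proof.
have [M MP] := line_outputs (nseq b (Advance true)) (Copy true :: nseq a (Advance true)).
have ex x n ps : exec x (nseq n (Advance true)) ps =
    (fun h => if h then ps true + n else ps false, [::]).
  elim: n ps => [|n IH] ps /=; first by congr pair; apply: bool_funext; rewrite ?addn0.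
  by rewrite IH; congr pair; apply: bool_funext => /=; rewrite ?addnS.
exists M => x; apply: (MP x _ (fun n h => if h then a * n + b else 0) 1) => //=; rewrite ?ex //=.
- by apply: bool_funext => /=; rewrite ?muln0.
- by move=> n; rewrite ex /=; apply: bool_funext => //=; rewrite mulnS; lia.
- by move=> n; rewrite ex.
- by move=> n [|j] // _; rewrite ex /= mul1n addn0.
Qed.

(** The prefix is the code of the length of a word of four letters, followed by
    the first two bits of a logical symbol, a function symbol and two
    parameters. *)
Lemma graph_map : exists M, forall x v,
  (forall j, j < 13 -> v j = (j \in [:: 0; 1; 2; 3; 7; 8; 10])) ->
  (forall n, [/\ v (13 + 4 * n) = false, v (14 + 4 * n) = x (4 * n),
                 v (15 + 4 * n) = x (4 * n + 2) & v (16 + 4 * n) = x (8 * n + 5)]) ->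
  outputs M x v.
Proof.
have [M MP] := line_outputs
  ([seq Emit (j \in [:: 0; 1; 2; 3; 7; 8; 10]) | j <- iota 0 13] ++ nseq 5 (Advance true))
  ([:: Emit false; Copy false; Advance false; Advance false; Copy false;
       Advance false; Advance false; Copy true] ++ nseq 8 (Advance true)).
exists M => x v v13 vn.
apply: (MP x v (fun n h => if h then 8 * n + 5 else 4 * n) 4) => //=.
- by apply: bool_funext.
- by do 13 (case; first by move=> _; rewrite v13).
- by move=> n; apply: bool_funext => /=; lia.
- move=> n; have [v0 v1 v2 v3] := vn n; rewrite addn2 in v2.
  by case=> [|[|[|[|j]]]] //= _; [rewrite -v0|rewrite -v1|rewrite -v2|rewrite -v3];
    congr (v _); lia.
Qed.

(** The arity varies with the symbol and cannot be kept in a finite set of states; the header of the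
    input has to serve as a counter. [RForth] to [RMoveH] write one bit and move up the header, the
    [RTail] stages pass its final 0, and [RBack] and [RSkip] lead down again. *)
Inductive rstage (S : nat) :=
  | RForth | RReadA | RReadC | REmit (b : bool) | RMoveA | RMoveC | RMoveH
  | RTail | RTailA | RTailC | RBack | RSkip (j : 'I_S.+1).

Arguments RForth {S}.
Arguments RReadA {S}.
Arguments RReadC {S}.
Arguments REmit {S}.
Arguments RMoveA {S}.
Arguments RMoveC {S}.
Arguments RMoveH {S}.
Arguments RTail {S}.
Arguments RTailA {S}.
Arguments RTailC {S}.
Arguments RBack {S}.

Section RStageFinite.
Variable S : nat.

Definition rstage_enc (s : rstage S) : 'I_10 + bool + 'I_S.+1 :=
  match s with
  | RForth => inl (inl (inord 0))
  | RReadA => inl (inl (inord 1))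
  | RReadC => inl (inl (inord 2))
  | RMoveA => inl (inl (inord 3))
  | RMoveC => inl (inl (inord 4))
  | RMoveH => inl (inl (inord 5))
  | RTail => inl (inl (inord 6))
  | RTailA => inl (inl (inord 7))
  | RTailC => inl (inl (inord 8))
  | RBack => inl (inl (inord 9))
  | REmit b => inl (inr b)
  | RSkip j => inr j
  end.

Definition rstage_dec (s : 'I_10 + bool + 'I_S.+1) : rstage S :=
  match s with
  | inl (inl i) => nth RForth [:: RForth; RReadA; RReadC; RMoveA; RMoveC;
                                  RMoveH; RTail; RTailA; RTailC; RBack] i
  | inl (inr b) => REmit b
  | inr j => RSkip j
  end.

Lemma rstage_encK : cancel rstage_enc rstage_dec.
Proof. by case=> //= *; rewrite inordK. Qed.

End RStageFinite.

HB.instance Definition _ S := Finite.copy (rstage S) (can_type (@rstage_encK S)).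

Section Columns.
Variables (sg tau : nat).
Hypothesis sg0 : 0 < sg.

(** The input and the output are a header [1^k 0] followed by columns of [k]
    bits.  The passes, in this order, write the header, the first two columns,
    and then one column each.  During a pass [hH] scans the header of the input
    forth and back to count up to [k]; [hA] and [hC] read the first bit and the
    other bits of a column, at different speeds. *)
Definition pass := (bool * bool)%type.
Notation header := (false, false).
Notation column0 := (false, true).
Notation column1 := (true, false).
Notation columns := (true, true).

Notation hH := (false, false).
Notation hA := (false, true).
Notation hC := (true, false).
Notation hW := (true, true).

Let st := (pass * rstage (sg + tau))%type.

Definition next_pass (X : pass) : pass :=
  match X with
  | header => column0
  | column0 => column1
  | _ => columns
  end.

(** The heads [hA] and [hC] move in the header pass, to get past the header, and in the column
    passes that read; the first two columns are written without reading. *)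
Definition advances (X : pass) : bool := X.1 == X.2.

(** On the way back [hC] makes this many moves per header cell, so it jumps over this many columns.
    It begins at column [tau]; later each pass has itself moved it by one column, which leaves
    [sg.-1] of [sg]. *)
Definition skip (X : pass) : nat :=
  match X with
  | column0 => tau
  | columns => sg.-1
  | _ => 0
  end.

Definition relation_head (q : st) : bool * bool :=
  match q.2 with
  | RForth | RMoveH | RBack => hH
  | RReadA | RMoveA | RTailA => hA
  | RReadC | RMoveC | RTailC | RSkip _ => hC
  | REmit _ | RTail => hW
  end.

Definition relation_act (q : st) (b o : bool) : st * option bool * option direction :=
  let X := q.1 in
  match q.2 with
  | RForth =>
      if b then
        ((X, match X with
             | header => REmit true
             | column0 => REmit (~~ o)
             | column1 => REmit o
             | columns => if o then RReadA else RReadC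
             end), None, None)
      else ((X, if X == header then RTail else RBack), None, None)
  | RReadA | RReadC => ((X, REmit b), None, None)
  | REmit e => ((X, if advances X then RMoveA else RMoveH), Some e, Some Right)
  | RMoveA => ((X, RMoveC), None, Some Right)
  | RMoveC => ((X, RMoveH), None, Some Right)
  | RMoveH => ((X, RForth), None, Some Right)
  | RTail => ((X, RTailA), Some false, Some Right)
  | RTailA => ((X, RTailC), None, Some Right)
  | RTailC => ((X, RBack), None, Some Right)
  | RBack => if o then ((next_pass X, RForth), None, None)
             else ((X, RSkip (inord (skip X))), None, Some Left)
  | RSkip j => if j == 0 :> nat then ((X, RBack), None, None)
               else ((X, RSkip (inord j.-1)), None, Some Right)
  end.

Definition relation_transducer : transducer :=
  @Transducer st (bool * bool)%type (header, RForth) relation_head relation_act.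

Definition rpos (h a c w : nat) (k : bool * bool) : nat :=
  match k with hH => h | hA => a | hC => c | hW => w end.

Definition rconf X s h a c w out : mconf relation_transducer :=
  @MConf relation_transducer (X, s) (rpos h a c w) out.

Variables (x v : real) (k : nat).
Hypothesis k0 : 0 < k.
Hypothesis x_one : forall p, p < k -> x p = true.
Hypothesis x_zero : x k = false.

Let I N : set (mconf relation_transducer) := fun m => agree v N (mout m).

Lemma agree_sub N w out : N <= w -> agree v w out -> agree v N out.
Proof. by move=> Nw ag p pN; apply: ag; apply: leq_trans Nw. Qed.

Lemma agree_emit w out b : v w = b -> agree v w out ->
  agree v w.+1 (fun p => if p == w then b else out p).
Proof.
move=> <- ag p; rewrite ltnS leq_eqVlt.
by case: (eqVneq p w) => [->|pw] //= /ag.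
Qed.

(** The first two columns hold the tag bits of [lettercode]: 01 for the symbol, in place 0, and 10
    for each parameter after it. *)
Definition emitted (X : pass) (j a c : nat) : bool :=
  match X with
  | header => true
  | column0 => 0 < j
  | column1 => j == 0
  | columns => if j == 0 then x a else x c
  end.

Lemma forth_step N X j a c w out : N <= w -> agree v w out -> j < k ->
  v w = emitted X j a c ->
  exists2 out', agree v w.+1 out' & 
    mwalk x (I N) (rconf X RForth j a c w out)
      (rconf X RForth j.+1 (a + advances X) (c + advances X) w.+1 out').
Proof.
move=> Nw ag jk vw; exists (fun p => if p == w then v w else out p).
  exact: agree_emit.
have [i1 i2] : agree v N out /\ agree v N (fun p => if p == w then v w else out p).
  by split; [apply: agree_sub ag|apply: (agree_sub (leqW Nw)); apply: agree_emit].
have tail : mwalk x (I N) (rconf X (REmit (v w)) j a c w out)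
    (rconf X RForth j.+1 (a + advances X) (c + advances X) w.+1 (fun p => if p == w then v w else out p)).
  apply: mwalkS => //.
  rewrite (@mstepE relation_transducer _ _ _ _ (X, if advances X then RMoveA else RMoveH) (Some (v w)) (Some Right)
    (rpos j a c w.+1) (fun p => if p == w then v w else out p)) //; last by move=> [[] []].
  case: (advances X); last first.
    rewrite !addn0; apply: mwalkS => //.
    rewrite (@mstepE relation_transducer _ _ _ _ (X, RForth) None (Some Right)
      (rpos j.+1 a c w.+1) (fun p => if p == w then v w else out p)) //; last by move=> [[] []].
    exact: mwalk0.
  rewrite !addn1; apply: mwalkS => //.
  rewrite (@mstepE relation_transducer _ _ _ _ (X, RMoveC) None (Some Right)
    (rpos j a.+1 c w.+1) (fun p => if p == w then v w else out p)) //; last by move=> [[] []].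
  apply: mwalkS => //.
  rewrite (@mstepE relation_transducer _ _ _ _ (X, RMoveH) None (Some Right)
    (rpos j a.+1 c.+1 w.+1) (fun p => if p == w then v w else out p)) //; last by move=> [[] []].
  apply: mwalkS => //.
  rewrite (@mstepE relation_transducer _ _ _ _ (X, RForth) None (Some Right)
    (rpos j.+1 a.+1 c.+1 w.+1) (fun p => if p == w then v w else out p)) //; last by move=> [[] []].
  exact: mwalk0.
apply: mwalkS => //.
case XE: (X == columns); last first.
  rewrite (@mstepE relation_transducer _ _ _ _ (X, REmit (v w)) None None (rpos j a c w) out) //.
  rewrite /= /relation_act /= x_one // vw.
  by case: X XE {vw tail} => [[] []] //= _; case: (j).
move/eqP: XE => XE; subst X.
rewrite (@mstepE relation_transducer _ _ _ _ (columns, if j == 0 then RReadA else RReadC) None None (rpos j a c w) out) //; last first.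
  by rewrite /= /relation_act /= x_one.
apply: mwalkS => //.
rewrite (@mstepE relation_transducer _ _ _ _ (columns, REmit (v w)) None None (rpos j a c w) out) //.
by rewrite vw /=; case: (j == 0).
Qed.

Lemma forth N X a c w out : N <= w -> agree v w out ->
  (forall j, j < k -> v (w + j) = emitted X j (a + advances X * j) (c + advances X * j)) ->
  exists2 out', agree v (w + k) out' & 
    mwalk x (I N) (rconf X RForth 0 a c w out)
      (rconf X RForth k (a + advances X * k) (c + advances X * k) (w + k) out').
Proof.
move=> Nw ag vE; suff: forall j, j <= k -> exists2 out', agree v (w + j) out' & 
    mwalk x (I N) (rconf X RForth 0 a c w out)
      (rconf X RForth j (a + advances X * j) (c + advances X * j) (w + j) out').
  by apply.
elim=> [|j IH] jk; first by exists out; rewrite ?muln0 !addn0 //; apply: mwalk0.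
have [out1 ag1 wk1] := IH (ltnW jk).
have [out2 ag2 wk2] := forth_step (leq_trans Nw (leq_addr j w)) ag1 jk (vE j jk).
exists out2; first by rewrite addnS.
by rewrite addnS !mulnSr !addnA; apply: mwalk_trans wk1 wk2.
Qed.

Lemma back N X a c w out : agree v N out ->
  mwalk x (I N) (rconf X RBack k a c w out)
    (rconf (next_pass X) RForth 0 a (c + skip X * k) w out).
Proof.
move=> ag.
have skp m c1 h : m <= skip X -> mwalk x (I N) (rconf X (RSkip (inord m)) h a c1 w out) (rconf X RBack h a (c1 + m) w out).
  have sk : skip X <= sg + tau by case: (X) => [[] []] /=; lia.
  elim: m c1 => [|m IH] c1 mX; apply: mwalkS => //.
    rewrite (@mstepE relation_transducer _ _ _ _ (X, RBack) None None (rpos h a c1 w) out) ?addn0 //.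
      exact: mwalk0.
    by rewrite /= /relation_act /= inordK.
  rewrite (@mstepE relation_transducer _ _ _ _ (X, RSkip (inord m)) None (Some Right) (rpos h a c1.+1 w) out) //.
  - by rewrite addnS -addSn; apply: IH; apply: ltnW.
  - by rewrite /= /relation_act /= inordK //; lia.
  - by move=> [[] []].
elim: (k) c => [|j IH] c1; apply: mwalkS => //.
  rewrite (@mstepE relation_transducer _ _ _ _ (next_pass X, RForth) None None (rpos 0 a c1 w) out) //.
  by rewrite muln0 addn0; apply: mwalk0.
rewrite (@mstepE relation_transducer _ _ _ _ (X, RSkip (inord (skip X))) None (Some Left) (rpos j a c1 w) out) //; last by move=> [[] []].
by apply: mwalk_trans (skp _ _ _ (leqnn _)) _; rewrite mulnS addnA; apply: IH.
Qed.

Lemma turn N X a c w out : X != header -> agree v N out ->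
  mwalk x (I N) (rconf X RForth k a c w out) (rconf X RBack k a c w out).
Proof.
move=> /negbTE Xh ag; apply: mwalkS => //.
rewrite (@mstepE relation_transducer _ _ _ _ (X, RBack) None None (rpos k a c w) out) //.
  exact: mwalk0.
by rewrite /= /relation_act /= x_zero Xh.
Qed.

Lemma turn_header a c w out : agree v w out -> v w = false ->
  exists2 out', agree v w.+1 out' &
  mwalk x (I 0) (rconf header RForth k a c w out) (rconf header RBack k a.+1 c.+1 w.+1 out').
Proof.
move=> ag vw; exists (fun p => if p == w then false else out p); first exact: agree_emit.
apply: mwalkS => //.
rewrite (@mstepE relation_transducer _ _ _ _ (header, RTail) None None (rpos k a c w) out) //; last first.
  by rewrite /= /relation_act /= x_zero.
apply: mwalkS => //.
rewrite (@mstepE relation_transducer _ _ _ _ (header, RTailA) (Some false) (Some Right)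
    (rpos k a c w.+1) (fun p => if p == w then false else out p)) //; last by move=> [[] []].
apply: mwalkS => //.
rewrite (@mstepE relation_transducer _ _ _ _ (header, RTailC) None (Some Right)
    (rpos k a.+1 c w.+1) (fun p => if p == w then false else out p)) //; last by move=> [[] []].
apply: mwalkS => //.
rewrite (@mstepE relation_transducer _ _ _ _ (header, RBack) None (Some Right)
    (rpos k a.+1 c.+1 w.+1) (fun p => if p == w then false else out p)) //; last by move=> [[] []].
exact: mwalk0.
Qed.

Hypothesis v_one : forall p, p < k -> v p = true.
Hypothesis v_zero : v k = false.
Hypothesis v_col0 : forall j, j < k -> v (k.+1 + j) = (0 < j).
Hypothesis v_col1 : forall j, j < k -> v (k.+1 + k + j) = (j == 0).
Hypothesis v_cols : forall n j, j < k ->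
  v (k.+1 + k * n.+2 + j) = x (k.+1 + k * (if j == 0 then n else sg * n + tau) + j).

Lemma relation_inv :
  let Inv n m := exists2 out, agree v (k.+1 + k * n.+2) out &
     m = rconf columns RForth 0 (k.+1 + k * n) (k.+1 + k * (sg * n + tau)) (k.+1 + k * n.+2) out in
  (exists2 m, mwalk x setT (MConf (mstart relation_transducer) (fun=> 0) zeros) m & Inv 0 m) /\
  forall n m, Inv n m -> (forall p, p < n -> mout m p = v p) /\
     exists2 m', mwalk x (fun m => forall p, p < n -> mout m p = v p) (mstep x m) m' & Inv n.+1 m'.
Proof.
move=> Inv; have ag0 out : agree v 0 out by [].
split.
  have [||o1 a1 w1] := @forth 0 header 0 0 0 zeros (leqnn 0) => //.
  have [|o2 a2 w2] := turn_header (advances header * k) (advances header * k) a1; first by rewrite v_zero.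
  have w3 := @back 0 header k.+1 k.+1 k.+1 o2 (ag0 _).
  have [|||o4 a4 w4] := @forth 0 column0 k.+1 k.+1 k.+1 o2 => //.
  have w5 := @turn 0 column0 k.+1 k.+1 (k.+1 + k) o4 isT (ag0 _).
  have w6 := @back 0 column0 k.+1 k.+1 (k.+1 + k) o4 (ag0 _).
  have [|||o7 a7 w7] := @forth 0 column1 k.+1 (k.+1 + tau * k) (k.+1 + k) o4 => //.
  have w8 := @turn 0 column1 k.+1 (k.+1 + tau * k) (k.+1 + k + k) o7 isT (ag0 _).
  have w9 := @back 0 column1 k.+1 (k.+1 + tau * k) (k.+1 + k + k) o7 (ag0 _).
  exists (rconf columns RForth 0 k.+1 (k.+1 + tau * k) (k.+1 + k + k) o7); last first.
    exists o7; first by rewrite muln2 -addnn addnA.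
    by rewrite !muln0 addn0 add0n muln2 -addnn addnA [k * tau]mulnC.
  suff: mwalk x (I 0) (rconf header RForth 0 0 0 0 zeros) (rconf columns RForth 0 k.+1 (k.+1 + tau * k) (k.+1 + k + k) o7).
    have -> : MConf (mstart relation_transducer) (fun=> 0) zeros = rconf header RForth 0 0 0 0 zeros.
      by rewrite /rconf; congr MConf; apply/funext => -[[] []].
    by elim=> [m|m m' _ _ IH]; [apply: mwalk0|apply: mwalkS].
  move: w1 w2 w3 w4 w5 w6 w7 w8 w9; rewrite /= !mul0n !mul1n !add0n !addn0.
  move=> w1 w2 w3 w4 w5 w6 w7 w8 w9.
  do 8 (apply: mwalk_trans; first by eassumption).
  by [].
move=> n m [out ag ->]; set w := k.+1 + k * n.+2.
have nw : n <= w by rewrite /w mulnS; have := leq_pmull n k0; lia.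
split; first by move=> p pn; apply: ag; apply: leq_trans nw.
have [|out' ag' w1] := @forth n columns (k.+1 + k * n) (k.+1 + k * (sg * n + tau)) w out nw ag.
  by move=> j jk; rewrite /w v_cols //= mul1n; case: (j == 0).
have agn : agree v n out' by apply: agree_sub ag'; lia.
have w2 := @turn n columns (k.+1 + k * n + k) (k.+1 + k * (sg * n + tau) + k) (w + k) out' isT agn.
have w3 := @back n columns (k.+1 + k * n + k) (k.+1 + k * (sg * n + tau) + k) (w + k) out' agn.
exists (rconf columns RForth 0 (k.+1 + k * n.+1) (k.+1 + k * (sg * n.+1 + tau)) (k.+1 + k * n.+3) out').
  apply: mwalk_neq; last first.
    move=> /(congr1 (fun m : mconf relation_transducer => mpos m hW)) /= E.
    have kn : k * n.+2 < k * n.+3 by rewrite ltn_pmul2l.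
    by move: E; rewrite /w; lia.
  move: w1 w2 w3; rewrite /= mul1n => w1 w2 w3.
  have -> : k.+1 + k * n.+1 = k.+1 + k * n + k by rewrite mulnS; lia.
  have -> : k.+1 + k * n.+3 = w + k by rewrite /w !mulnS; lia.
  have -> : k.+1 + k * (sg * n.+1 + tau) = k.+1 + k * (sg * n + tau) + k + sg.-1 * k.
    by case: (sg) sg0 => // g _; rewrite /= (mulnS g.+1 n) -addnA mulnDr (mulnS k g) [g * k]mulnC; lia.
  apply: mwalk_trans w1 _; apply: mwalk_trans w2 _; exact: w3.
by exists out'; rewrite // /w (_ : k * n.+3 = k * n.+2 + k) ?addnA // mulnS addnC.
Qed.

End Columns.

Lemma relation_map (sg tau : nat) : 0 < sg -> exists M, forall (x v : real) k,
  0 < k -> (forall p, p < k -> x p) -> x k = false ->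
  (forall p, p < k -> v p) -> v k = false ->
  (forall j, j < k -> v (k.+1 + j) = (0 < j)) ->
  (forall j, j < k -> v (k.+1 + k + j) = (j == 0)) ->
  (forall n j, j < k ->
    v (k.+1 + k * n.+2 + j) = x (k.+1 + k * (if j == 0 then n else sg * n + tau) + j)) ->
  outputs M x v.
Proof.
move=> sg0; have [M MP] := transduction (relation_transducer sg tau).
exists M => x v k k0 x1 x0 v1 v0 c0 c1 cs.
by have [I0 IS] := relation_inv sg0 k0 x1 x0 v1 v0 c0 c1 cs; apply: MP I0 IS.
Qed.

(** * The presentation *)

Lemma natcode_inj : injective natcode.
Proof.
move=> m n E; apply/eqP; rewrite eqn_leq.
have := congr1 (fun x => x m) E; have := congr1 (fun x => x n) E.
by rewrite /natcode !ltnn; lia.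
Qed.

Lemma bcons_inj b b' x x' : bcons b x = bcons b' x' -> b = b' /\ x = x'.
Proof.
move=> E; split; first exact: (congr1 (fun y => y 0) E).
by apply/funext => n; exact: (congr1 (fun y => y n.+1) E).
Qed.

(** The equality sign is [Logical 0], so its letter code is the zero real. *)
Lemma zeros_bcons : zeros = bcons false (bcons false (natcode 0)).
Proof. by apply/funext => -[|[|]]. Qed.

Lemma seqcodeE s m j : j < size s ->
  seqcode s ((size s).+1 + size s * m + j) = nth zeros s j m.
Proof.
move=> js; rewrite /seqcode ltnNge ifF; last by lia.
rewrite ifF; last by lia.
have -> : (size s).+1 + size s * m + j - (size s).+1 = m * size s + j by rewrite mulnC; lia.
by rewrite modnMDl modn_small // divnMDl ?divn_small ?addn0 //; lia.
Qed.

Lemma seqcode_lt s p : p < size s -> seqcode s p.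
Proof. by rewrite /seqcode => ->. Qed.

Lemma seqcode_size s : seqcode s (size s) = false.
Proof. by rewrite /seqcode ltnn eqxx. Qed.

Lemma seqcode_inj : injective seqcode.
Proof.
move=> s t E; have sz : size s = size t.
  case: (ltngtP (size s) (size t)) => // lt.
    by have := seqcode_size s; rewrite E seqcode_lt.
  by have := seqcode_size t; rewrite -E seqcode_lt.
apply: (@eq_from_nth _ zeros) => // j js; apply/funext => m.
have jt : j < size t by rewrite -sz.
by rewrite -(seqcodeE m js) -(seqcodeE m jt) E sz.
Qed.

Lemma in_asbool (S : set real) x : (x \in S) = `[< S x >].
Proof. by apply: bool_iff_eq; rewrite !inE. Qed.

Section Words.
Variables (L : computable_language) (A : real_model L).
Local Notation D := (dom A).

Lemma lettercode_inj : injective (@lettercode L A).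
Proof.
move=> [n|s|a] [n'|s'|a'] /= /bcons_inj [//] _ /bcons_inj [//] _.
- by move=> /natcode_inj ->.
- by move=> /gcode_inj ->.
- by move=> /val_inj ->.
Qed.

Lemma formulacode_inj p q : formulacode (A := A) p = formulacode q -> fword p = fword q.
Proof. by move=> /seqcode_inj/(inj_map lettercode_inj). Qed.

(** The word of a term is never empty, and begins with a parameter only if the term is that
    parameter. This much of unique readability suffices below. *)
Lemma tword_params (ts : seq (term L D)) (s : seq D) :
  flatten (map (@tword L D) ts) = map Param s -> ts = map Par s.
Proof.
elim: ts s => [|t ts IH] [|a s] //=; first by case: t.
by case: t => [i|b|k|f us] //= [<- /IH ->].
Qed.

Lemma fword_rel r (s : seq D) p : fword p = Sym (SRel r) :: map Param s ->
  exists2 ts, p = @Rel L D r ts & map ts (enum 'I_(relar r)) = map Par s.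
Proof.
case: p => [t u|r' ts|q|q q'|q q'|q q'|i q|i q] //= [E]; subst r'.
move=> E; exists ts => //; apply: tword_params; rewrite -E.
by rewrite -map_comp.
Qed.

Lemma fword_graph s (a b : D) p : (cstsym L -> False) ->
  fword p = [:: Logical 0; Sym s; Param a; Param b] ->
  exists f ts, [/\ s = SFun f, p = Eq (@App L D f ts) (Par b) & forall i, ts i = Par a].
Proof.
move=> nocst.
case: p => [t u|r' ts|q|q q'|q q'|q q'|i q|i q] //= [].
case: t => [i|c|k|f ts] //=.
move=> [<- E].
(* The arguments of [f] and the right-hand side are read off together, which leaves exactly one
   argument for [f]. *)
have : [seq ts i | i <- enum 'I_(funar f)] ++ [:: u] = map Par [:: a; b].
  by apply: tword_params; rewrite map_cat flatten_cat /= cats0 -map_comp.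
rewrite cats1 => /(@rcons_inj _ _ [:: Par a] _ (Par b)) [tsE ->].
exists f, ts; split=> // i.
have n1 : funar f = 1 by have := congr1 size tsE; rewrite size_map size_enum_ord.
have := congr1 (fun s => nth (Var 0) s i) tsE.
rewrite (nth_map i) ?size_enum_ord // nth_ord_enum => ->.
by have := ltn_ord i; rewrite [X in _ < X]n1; case: (i : nat).
Qed.

Lemma fword_params r (a : (relar r).-tuple D) :
  fword (Rel (fun i => Par (tnth a i))) = Sym (SRel r) :: map Param a :> seq (letter L D).
Proof.
rewrite /=; congr (_ :: _); rewrite -[in RHS](map_tnth_enum a).
by elim: (enum _) => //= i s ->.
Qed.

Lemma formulacode_rel r (a : (relar r).-tuple D) :
  formulacode (A := A) (Rel (fun i => Par (tnth a i))) =
  seqcode (bcons false (bcons true (gcode (SRel r))) ::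
           [seq bcons true (bcons false (sval u)) | u <- a]).
Proof.
by rewrite /formulacode fword_params /= -map_comp.
Qed.

Lemma diagram_rel r (a : (relar r).-tuple D) :
  elementary_diagram A (formulacode (A := A) (Rel (fun i => Par (tnth a i)))) <->
  rel_interp A a.
Proof.
have aE e : mktuple (fun i => eval A e (Par (tnth a i))) = a.
  by apply: eq_from_tnth => i; rewrite tnth_mktuple.
split=> [[p [_ mp /formulacode_inj]]|ra]; last first.
  by exists (Rel (fun i => Par (tnth a i))); split=> // e /=; rewrite aE.
rewrite fword_params => /fword_rel [ts E tsE].
have tsP i : ts i = Par (tnth a i).
  have := congr1 (fun s => nth (Var 0) s i) tsE.
  by rewrite (nth_map i) ?size_enum_ord // nth_ord_enum (nth_map (tnth a i)) ?size_tuple // -tnth_nth.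
(* [models] quantifies over assignments, and a point of the domain provides one. *)
have [d Dd] := dom_nonempty A.
pose e := fun _ : nat => exist (fun x => x \in D) d (mem_set Dd) : D.
have := mp e; rewrite E /=; congr (rel_interp A _).
by apply: eq_from_tnth => i; rewrite tnth_mktuple tsP.
Qed.

Lemma formulacode_graph f (a b : D) : funar f = 1 ->
  formulacode (A := A) (Eq (App (fun _ : 'I_(funar f) => Par a)) (Par b)) =
  seqcode [:: zeros; bcons false (bcons true (gcode (SFun f)));
              bcons true (bcons false (sval a)); bcons true (bcons false (sval b))].
Proof.
move=> f1; rewrite zeros_bcons /formulacode /=; congr (seqcode (_ :: _ :: _)).
have -> : [seq [:: Param (L := L) a] | _ <- enum 'I_(funar f)] = [:: [:: Param a]].
  have := size_enum_ord (funar f); rewrite [X in _ = X]f1.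
  by case: (enum _) => [|i []].
by [].
Qed.

(** The three reals are arbitrary: membership in the diagram alone certifies that [g] codes a
    function symbol and that [a] and [b] belong to the universe. *)
Lemma diagram_graph (g : real) (a b : real) : (cstsym L -> False) ->
  elementary_diagram A (seqcode [:: zeros; bcons false (bcons true g);
      bcons true (bcons false a); bcons true (bcons false b)]) ->
  exists f a' b', [/\ g = gcode (@SFun L f), a = sval (a' : D), b = sval (b' : D) &
     fun_interp A (nseq_tuple (funar f) a') = b'].
Proof.
move=> nocst [p [_ mp /seqcode_inj]].
case E : (fword p) => [|l0 [|l1 [|l2 [|l3 [|]]]]] //= [E0 E1 E2 E3].
have {}E0 : l0 = Logical 0.
  by apply: lettercode_inj; rewrite E0 zeros_bcons.
case: l1 E E1 => [n|s|c] E /= /bcons_inj [//] _ /bcons_inj [//] _ gE.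
case: l2 E E2 => [n|s'|a'] E /= /bcons_inj [//] _ /bcons_inj [//] _ aE.
case: l3 E E3 => [n|s'|b'] E /= /bcons_inj [//] _ /bcons_inj [//] _ bE.
rewrite E0 in E; have [f [ts [sE pE tsE]]] := fword_graph nocst E.
exists f, a', b'; split=> //; first by rewrite -gE sE.
have := mp (fun=> a'); rewrite pE /= => <-; congr (fun_interp A _).
by apply: eq_from_tnth => i; rewrite tnth_mktuple tsE /= tnth_nseq.
Qed.

Lemma graph_diagram f (a : D) : funar f = 1 ->
  elementary_diagram A (seqcode [:: zeros; bcons false (bcons true (gcode (SFun f)));
     bcons true (bcons false (sval a));
     bcons true (bcons false (sval (fun_interp A (nseq_tuple (funar f) a))))]).
Proof.
move=> f1; set b := fun_interp A _.
exists (Eq (App (fun _ : 'I_(funar f) => Par a)) (Par b)); split=> //.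
  move=> e /=; rewrite /b; congr (fun_interp A _).
  by apply: eq_from_tnth => i; rewrite tnth_mktuple tnth_nseq.
exact: formulacode_graph.
Qed.

End Words.

Section Transport.
Variables (L : computable_language) (A : real_model L).
Variables (DB : set real) (h : dom A -> DB) (h' : DB -> dom A).
Hypotheses (hK : cancel h h') (h'K : cancel h' h).

Definition transported_structure : structure L DB :=
  Structure (fun r (a : (relar r).-tuple DB) => rel_interp A (map_tuple h' a))
            (fun f a => h (fun_interp A (map_tuple h' a)))
            (fun k => h (cst_interp A k)).

Lemma transported_nonempty : DB !=set0.
Proof.
by have [x Ax] := dom_nonempty A; exists (sval (h (exist _ x (mem_set Ax)))); apply: set_valP.
Qed.

Definition transported : real_model L := RealModel transported_nonempty transported_structure.

Lemma map_tupleK n (a : n.-tuple (dom A)) : map_tuple h' (map_tuple h a) = a.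
Proof. by apply: val_inj; rewrite /= (mapK hK). Qed.

Lemma transported_isomorphic : isomorphic A transported.
Proof.
exists h; split=> //.
- by exists h'.
- by move=> r a /=; rewrite map_tupleK.
- by move=> f a /=; rewrite map_tupleK.
Qed.

(** The bits of the original element lie in an arithmetic progression inside its new code, so
    [relation_map] can rewrite the input into an atomic sentence about the original model. *)
Lemma transported_relations (sg tau : nat) : 0 < sg ->
  (forall a n, sval a n = sval (h a) (sg * n + tau)) ->
  ittm_decidable (elementary_diagram A) ->
  exists M, forall (r : relsym L) (a : (relar r).-tuple DB),
    outputs M (inputcode (A := transported) (SRel r) a)
      (natcode `[< rel_interp transported (r := r) a >]).
Proof.
move=> sg0 hE [M1 M1P]; have [M2 M2P] := relation_map tau sg0.
have [M MP] := composition M2 M1; exists M => r a.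
set b := map_tuple h' a.
have -> : `[< rel_interp transported (r := r) a >] =
    (formulacode (A := A) (Rel (fun i => Par (tnth b i))) \in elementary_diagram A).
  by rewrite in_asbool; apply/asbool_equiv_eq; rewrite diagram_rel.
apply: MP (M1P _); rewrite formulacode_rel.
set s := _ :: _; set x := inputcode _ _.
have ss : size s = (relar r).+1 by rewrite /= size_map size_tuple.
pose s1 : seq real := gcode (SRel r) :: map (fun u => sval u) a.
have ss1 : size s1 = (relar r).+1 by rewrite /= size_map size_tuple.
have sE m j : j < (relar r).+1 ->
    seqcode s ((relar r).+2 + (relar r).+1 * m + j) = nth zeros s j m.
  by rewrite -ss; apply: seqcodeE.
have s1E m j : j < (relar r).+1 -> x ((relar r).+2 + (relar r).+1 * m + j) = nth zeros s1 j m.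
  by rewrite -ss1; apply: seqcodeE.
have sn j : j < relar r -> nth zeros s j.+1 =
    bcons true (bcons false (fun n => nth zeros s1 j.+1 (sg * n + tau))).
  move=> jr; pose u := tnth a (Ordinal jr).
  rewrite /= (nth_map (h' u)) ?size_tuple // (nth_map u) ?size_tuple //.
  congr (bcons _ (bcons _ _)); apply/funext => n; rewrite hE.
  by rewrite h'K (nth_map u) ?size_tuple.
apply: (M2P _ _ (relar r).+1) => //.
- by move=> p pk; apply: seqcode_lt; rewrite ss1.
- by rewrite -ss1; apply: seqcode_size.
- by move=> p pk; apply: seqcode_lt; rewrite ss.
- by rewrite -ss; apply: seqcode_size.
- move=> j jk; have := sE 0 j jk; rewrite muln0 addn0 => ->.
  by case: j jk => // j jk; rewrite sn.
- move=> j jk; have := sE 1 j jk; rewrite muln1 => ->.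
  by case: j jk => // j jk; rewrite sn.
- move=> n j jk; rewrite sE // s1E //.
  by case: j jk => // j jk; rewrite sn.
Qed.

End Transport.

Section OrbitCode.
Variables (T : Type) (c : real) (r : T -> real) (f : T -> T).

(** The orbit of [a] under [f], interleaved with [c]: bits [4n] hold [c], bits
    [4n + 2] hold [a], and bits [2n + 1] hold the code of the orbit of [f a].
    The first argument bounds the depth of the recursion. *)
Fixpoint orbit_bit (d : nat) (a : T) (m : nat) : bool :=
  if d is d'.+1 then
    if odd m then orbit_bit d' (f a) m./2
    else if odd m./2 then r a m./2./2 else c m./2./2
  else false.

(** Depth [m.+1] is enough because each recursive call at least halves the position. *)
Definition orbit_code (a : T) : real := fun m => orbit_bit m.+1 a m.

Lemma orbit_bit_depth d a m : m < d -> orbit_bit d a m = orbit_code a m.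
Proof.
suff main n : forall d d' a m, m < n -> m < d -> m < d' -> orbit_bit d a m = orbit_bit d' a m.
  by move=> md; apply: (main m.+1).
elim: n => // n IH [|d1] [|d2] b p //= pn pd1 pd2.
by case: ifP => // op; apply: IH; lia.
Qed.

Lemma orbit_code_odd a n : orbit_code a (2 * n + 1) = orbit_code (f a) n.
Proof.
rewrite /orbit_code /= (_ : odd (2 * n + 1)); last by rewrite addn1 /= oddM.
rewrite (_ : (2 * n + 1)./2 = n); last by lia.
by rewrite orbit_bit_depth //; lia.
Qed.

Lemma orbit_code_const a n : orbit_code a (4 * n) = c n.
Proof. by rewrite /orbit_code /= !ifF //; try (congr c); lia. Qed.

Lemma orbit_code_elt a n : orbit_code a (4 * n + 2) = r a n.
Proof. by rewrite /orbit_code /= ifF ?ifT //; try (congr r); lia. Qed.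

Definition shift_code (x : real) : real := fun n => x (2 * n + 1).

Lemma shift_orbit_code a i : iter i shift_code (orbit_code a) = orbit_code (iter i f a).
Proof.
elim: i => //= i ->; apply/funext => n; exact: orbit_code_odd.
Qed.

(** Since [8 * n + 5 = 2 * (4 * n + 2) + 1], the value recorded in one shift is the element recorded
    in the next. By injectivity of [r] the recorded elements form an orbit, and this determines all
    bits. *)
Lemma orbit_codeP x : injective r ->
  (forall i, exists a, [/\ forall n, iter i shift_code x (4 * n) = c n,
     forall n, iter i shift_code x (4 * n + 2) = r a n &
     forall n, iter i shift_code x (8 * n + 5) = r (f a) n]) ->
  exists a, orbit_code a = x.
Proof.
move=> r_inj /choice [a aP].
have aS i : a i.+1 = f (a i).
  apply: r_inj; apply/funext => n.
  have [_ <- _] := aP i.+1; have [_ _ <-] := aP i.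
  by rewrite /= {1}/shift_code; congr (iter _ _ _ _); lia.
exists (a 0); apply/funext => m; rewrite -[x]/(iter 0 shift_code x).
(* The number of shifts is generalized from 0, as an odd position passes to the next shift. *)
elim/ltn_ind: m 0 => m IH i; have [c_i r_i _] := aP i.
have [[n E]|[[n E]|[n E]]] : (exists n, m = 2 * n + 1) \/ (exists n, m = 4 * n) \/ exists n, m = 4 * n + 2.
  case: (boolP (odd m)) => om; first by left; exists m./2; lia.
  case: (boolP (odd m./2)) => om2; first by right; right; exists m./2./2; lia.
  by right; left; exists m./2./2; lia.
- by rewrite E orbit_code_odd -aS IH //; lia.
- by rewrite E orbit_code_const c_i.
- by rewrite E orbit_code_elt r_i.
Qed.

End OrbitCode.

Section UnaryFunction.
Variables (L : computable_language) (A : real_model L).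
Variable f0 : funsym L.
Hypotheses (f0_ar : funar f0 = 1) (f0_unique : forall g, g = f0).
Hypothesis nocst : cstsym L -> False.
Hypothesis diagram_dec : ittm_decidable (elementary_diagram A).

Let c := gcode (SFun f0).
Let r (a : dom A) : real := sval a.
Let fA (a : dom A) : dom A := fun_interp A (nseq_tuple (funar f0) a).

Definition graph_code (x : real) : real :=
  seqcode [:: zeros; bcons false (bcons true (fun n => x (4 * n)));
     bcons true (bcons false (fun n => x (4 * n + 2)));
     bcons true (bcons false (fun n => x (8 * n + 5)))].

Lemma graph_code_computable : exists M, forall x, outputs M x (graph_code x).
Proof.
have [M MP] := graph_map; exists M => x; apply: MP.
  (* Cells 0 to 4 are the header [11110], cells 5 to 8 the first tag bits [0011], cells 9 to 12 the
     second tag bits [0100]. *)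
  by do 13 (case => //).
pose s := [:: zeros; bcons false (bcons true (fun n => x (4 * n)));
     bcons true (bcons false (fun n => x (4 * n + 2)));
     bcons true (bcons false (fun n => x (8 * n + 5)))].
move=> n; have E j : j < 4 -> seqcode s (5 + 4 * n.+2 + j) = nth zeros s j n.+2.
  exact: (@seqcodeE s).
split; [apply: etrans (E 0 isT)|apply: etrans (E 1 isT)|apply: etrans (E 2 isT)|
  apply: etrans (E 3 isT)]; rewrite /graph_code; congr (seqcode _ _); lia.
Qed.

Definition orbits : set real := [set x | exists a, orbit_code c r fA a = x].

Lemma orbitsP x : orbits x <->
  forall i, graph_code (iter i shift_code x) \in elementary_diagram A.
Proof.
split=> [[a <-] i|all_i].
  rewrite in_asbool; apply/asboolP; rewrite shift_orbit_code.
  set b := iter i fA a; rewrite /graph_code.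
  have -> : (fun n => orbit_code c r fA b (4 * n)) = c.
    by apply/funext => n; rewrite orbit_code_const.
  have -> : (fun n => orbit_code c r fA b (4 * n + 2)) = r b.
    by apply/funext => n; rewrite orbit_code_elt.
  have -> : (fun n => orbit_code c r fA b (8 * n + 5)) = r (fA b).
    apply/funext => n; rewrite (_ : 8 * n + 5 = 2 * (4 * n + 2) + 1); last by lia.
    by rewrite orbit_code_odd orbit_code_elt.
  exact: graph_diagram.
apply: orbit_codeP; first exact: val_inj.
move=> i; have := all_i i; rewrite in_asbool => /asboolP.
move=> /(diagram_graph nocst) [f [a [b [gE aE bE fab]]]].
move: (f0_unique f) => E; subst f; exists a; split=> n.
- by rewrite /c -gE.
- by rewrite /r -aE.
- by rewrite /fA fab /r -bE.
Qed.

Lemma orbits_decidable : ittm_decidable orbits.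
Proof.
have [M1 M1P] := diagram_dec; have [M2 M2P] := graph_code_computable.
have [M3 M3P] := composition M2 M1.
have [M4 M4P] := affine_map 2 1.
have [M MP] := @iteration M3 M4 (fun x => graph_code x \in elementary_diagram A) shift_code
  (fun x => M3P _ _ _ (M2P x) (M1P _)) M4P.
exists M => x; have := MP x; congr (outputs _ _ (natcode (nat_of_bool _))).
rewrite [RHS]in_asbool; apply: asbool_equiv_eq; exact: (iff_sym (orbitsP x)).
Qed.

Let h (a : dom A) : orbits :=
  exist _ (orbit_code c r fA a) (mem_set (ex_intro _ a erefl)).
Let h' (x : orbits) : dom A := projT1 (cid (set_valP x)).

Let h'K : cancel h' h.
Proof. by move=> x; apply: val_inj; rewrite /= /h' ; case: cid. Qed.

Let hK : cancel h h'.
Proof.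
move=> a; apply: val_inj; apply/funext => n.
rewrite -[LHS](orbit_code_elt c r fA) -[RHS](orbit_code_elt c r fA).
by have := congr1 sval (h'K (h a)) => /= ->.
Qed.

Lemma unary_presentation : has_computable_presentation A.
Proof.
exists (transported h h'); split; last exact: transported_isomorphic.
split.
- exact: orbits_decidable.
- apply: (@transported_relations _ _ _ h h' h'K 4 2) => // a n.
  by rewrite /= orbit_code_elt.
(* The code of two reals has bit [m] of its second entry in cell [3 + 2 * m + 1]; the value of the
   function has the bits [m = 2 * n + 1] of the argument, hence cell [4 * n + 6]. *)
- have [M MP] := affine_map 4 6; exists M => f a.
  move: (f0_unique f) => E; subst f.
  have [u au] : exists u, tval a = [:: u].
    have := size_tuple a; rewrite [RHS]f0_ar.
    by case: (tval a) => [|u []] // _; exists u.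
  have -> : sval (fun_interp (transported h h') a) = fun n => inputcode (A := transported h h') (SFun f0) a (4 * n + 6).
    apply/funext => n /=.
    rewrite (_ : map_tuple h' a = nseq_tuple (funar f0) (h' u)); last first.
      by apply: val_inj; rewrite /= au f0_ar.
    rewrite -[fun_interp A _]/(fA (h' u)) -orbit_code_odd.
    rewrite (_ : orbit_code c r fA (h' u) = sval u); last exact: (congr1 sval (h'K u)).
    rewrite /inputcode au /=.
    have := @seqcodeE [:: gcode (SFun f0); sval u] (2 * n + 1) 1 isT => /= <-.
    by congr (seqcode _ _); lia.
  exact: MP.
- have [M _] := affine_map 0 0; exists M => k; case: (nocst k).
Qed.

End UnaryFunction.

Theorem theorem40 (L : computable_language) (A : real_model L) :
  purely_relational L \/ relational_plus_unary_function L ->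
  decidable_model A ->
  has_computable_presentation A.
Proof.
move=> [[nofun nocst]|[[f [f1 f_unique]] nocst]] [domA diagA]; last first.
  exact: (unary_presentation f1 f_unique nocst diagA).
have idK : cancel (@id (dom A)) id by [].
exists (@transported L A (dom A) id id); split; last exact: transported_isomorphic.
(* Any machine will do for the function and constant clauses, which are vacuous here. *)
have [M0 _] := affine_map 0 0.
split=> //.
- by apply: (@transported_relations _ _ _ id id idK 1 0) => // a n; rewrite mul1n addn0.
- by exists M0 => f; case: (nofun f).
- by exists M0 => k; case: (nocst k).
Qed.
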